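(* Let $1<q<\infty$, let $\alpha=(\alpha_n)_{n\in\mathbb{N}}\in\ell^2$ and $f_\alpha(z)=\sum_{n\ge0}\alpha_n z^n$. The following statements are equivalent: (i) the Rhaly operator $R_\alpha$, $(R_\alpha f)(k)=\alpha_k\sum_{j=0}^k f(j)$, belongs to the Schatten class $\mathcal{S}^q(\ell^2)$; (ii) $f_\alpha$ belongs to the Besov space $\mathcal{B}^{2,q}_{1/2}$; (iii) $\displaystyle\sum_{n=0}^\infty\Big(2^n\sum_{j=2^n}^{2^{n+1}-1}|\alpha_j|^2\Big)^{q/2}<\infty$.
   Context: $\mathbb{N}=\{0,1,2,\dots\}$; $\ell^2$ is the Hilbert space of square-summable functions $\mathbb{N}\to\mathbb{C}$. For a bounded operator $T$ on $\ell^2$, the approximation numbers are $a_{n+1}(T)=\inf\{\|T-P\|: P \text{ linear on } \ell^2 \text{ with rank}\le n\}$, $n\ge0$, and $T\in\mathcal{S}^q(\ell^2)$ iff $(a_n(T))_{n\ge1}\in\ell^q$. The Besov space is $\mathcal{B}^{2,q}_{1/2}=\{f \text{ holomorphic on } \mathbb{D}: \int_0^1(1-r)^{q/2-1}\big(\int_0^{2\pi}|f'(re^{i\theta})|^2d\theta\big)^{q/2}r\,dr<\infty\}$. *)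

(* Defs.v *)
From mathcomp Require Import all_boot all_order all_algebra.
From mathcomp Require Import all_classical all_reals all_analysis.
From mathcomp Require Export complex.
Set Implicit Arguments. Unset Strict Implicit. Unset Printing Implicit Defensive.
Import Order.TTheory GRing.Theory Num.Theory.
Import numFieldNormedType.Exports.
Local Open Scope classical_set_scope.
Local Open Scope ring_scope.
Local Open Scope complex_scope.

Section Defs.
Local Notation normc := Normc.normc.
Variable R : realType.
Local Notation C := R[i].

Definition seqC := nat -> C.

Definition l2sq (f : seqC) : \bar R :=
  (\sum_(0 <= n <oo) ((normc (f n)) ^+ 2)%:E)%E.

Definition in_l2 (f : seqC) : Prop := (l2sq f < +oo)%E.

(** operator norm ||T|| = sup { ||T f|| : f in l^2, ||f|| <= 1 } (in \bar R);
    it is +oo if some T f is not in l^2 or the set is unbounded *)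
Definition opnorm (T : seqC -> seqC) : \bar R :=
  ereal_sup [set (if l2sq (T f) is (x%:E)%E then (Num.sqrt x)%:E else +oo)%E
            | f in [set f | in_l2 f /\ (l2sq f <= 1)%E]].

Definition linear_on_l2 (P : seqC -> seqC) : Prop :=
  (forall f, in_l2 f -> in_l2 (P f)) /\
  (forall (a : C) f g, in_l2 f -> in_l2 g ->
     P (fun k => a * f k + g k) = (fun k => a * P f k + P g k)).

Definition rank_le (P : seqC -> seqC) (n : nat) : Prop :=
  exists v : 'I_n -> seqC, (forall i, in_l2 (v i)) /\
    forall f, in_l2 f -> exists c : 'I_n -> C,
      P f = (fun k => \sum_(i < n) c i * v i k).

(** approx_num T n = a_{n+1}(T)
     = inf { ||T - P|| : P linear on l^2 with rank <= n } *)
Definition approx_num (T : seqC -> seqC) (n : nat) : \bar R :=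
  ereal_inf [set opnorm (fun f k => T f k - P f k)
            | P in [set P | linear_on_l2 P /\ rank_le P n]].

Definition in_Schatten (q : R) (T : seqC -> seqC) : Prop :=
  (opnorm T < +oo)%E /\
  (forall n, (approx_num T n < +oo)%E) /\
  (\sum_(0 <= n <oo) (((fine (approx_num T n)) `^ q)%:E) < +oo)%E.

Definition rhaly (alpha : seqC) (f : seqC) : seqC :=
  fun k => alpha k * \sum_(0 <= j < k.+1) f j.

Definition falpha (alpha : seqC) (z : C) : C :=
  limn (series (fun n => (alpha n * z ^+ n : C^o))).

Definition cderiv (f : C -> C) (z : C) : C := 'D_1 (f : C^o -> C^o) z.

Definition holomorphic_on_disc (f : C -> C) : Prop :=
  forall z : C, normc z < 1 -> derivable (f : C^o -> C^o) z 1.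

Definition circle_int (f : C -> C) (r : R) : \bar R :=
  (\int[lebesgue_measure]_(t in `[0%R, (2 * pi)%R]%classic)
     ((normc (cderiv f (r%:C * (cos t +i* sin t)))) ^+ 2)%:E)%E.

Definition in_Besov (q : R) (f : C -> C) : Prop :=
  holomorphic_on_disc f /\
  (\int[lebesgue_measure]_(r in `]0%R, 1%R[%classic)
     (((1 - r) `^ (q / 2 - 1))%:E * poweR (circle_int f r) (q / 2) * r%:E)
   < +oo)%E.

Definition dyadic_cond (q : R) (alpha : seqC) : Prop :=
  (\sum_(0 <= n <oo)
     (((2 ^+ n) * \sum_(2 ^ n <= j < 2 ^ n.+1) (normc (alpha j)) ^+ 2)
        `^ (q / 2))%:E < +oo)%E.

End Defs.

(* Main.v *)
Require Import Defs.
From mathcomp Require Import all_boot all_order all_algebra.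
From mathcomp Require Import all_classical all_reals all_analysis.
From mathcomp Require Import complex.
From mathcomp Require Import measurable_realfun spectral ring lra zify.
Import Order.TTheory GRing.Theory Num.Theory.
Import numFieldNormedType.Exports.
Set Implicit Arguments. Unset Strict Implicit. Unset Printing Implicit Defensive.
Local Open Scope ring_scope.

(** Put [I_0 = {0}], [I_n = {2^(n-1), ..., 2^n - 1}] for [n >= 1], and
    [beta_n^2 = 2^n sum_(j in I_n) |alpha_j|^2], so that (iii) reads [beta \in l^q].

    Besov. By Parseval the circle integral at radius [r] is
    [2 pi sum_j j^2 |alpha_j|^2 r^(2j-2)]; for [2^-(n+1) <= 1 - r < 2^-n] it is at least
    [c 2^n beta_n^2] and at most [C 2^n sum_k 2^-|n-k| beta_k^2], and convolution with a
    geometric kernel is bounded on [l^p] for every [p > 0].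

    Schatten, upper bound. Given [t > 0], cut each [I_n] with [beta_n >= t] into
    O(beta_n / t) cells on each of which both mass and length are small, and subtract
    from [R_alpha f (k)] the part of the sum that precedes the cell of [k]. The
    subtracted operator has rank O(sum_(beta_n >= t) beta_n / t); the remainder has norm
    O(t), by Cauchy-Schwarz on the cells and Hardy's inequality on the other blocks.
    Thus [t #{n : a_n >= t} <= C sum_(beta_n >= c t) beta_n], which gives the bound in
    [l^q] after summation over dyadic [t], since [q > 1].

    Schatten, lower bound. Testing [R_alpha] on the normalised indicators of [I_n] and
    the normalised restrictions of [alpha] to [I_(n+1)] gives matrices with diagonal
    entries at least [beta_(n+1) / 2]. Since [|tr A| <= rank A * ||A||], telescoping
    over near-optimal approximants of rank [2^i - 1] bounds [t #{n : beta_n >= 2 t}] by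
    [C sum 2^i a_(2^i)] over the [i] with [a_(2^i) >= c t], and one concludes as above. *)

(** Both Schatten directions bound [t] times a counting function by a tail of the other sequence.
    Passing from this to l^q sums t^(q-1) over the dyadic [t] below a given value, a geometric
    series because q > 1. Mass and length are cut at the same time because Cauchy-Schwarz on a cell
    costs their product: with [m] pieces of each, block [n] costs mass * 2^n / m^2 = (beta_n / m)^2,
    so m of order beta_n / t suffices. The subtracted sum is constant on a cell, whence one
    dimension per cell. A point of large mass cannot be cut; it becomes the first point of a cell,
    and the subtracted sum includes that point. In the lower bound the output block is shifted by
    one so that the partial sums of the indicator of [I_n] are complete on it. The matrices need not
    be diagonal, but the trace ignores the other entries, and the set of test blocks may be chosen
    anew for each [t]. The Besov half applies the convolution bound to beta^2 with exponent q/2,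
    which may be below 1, out of reach of the triangle inequality in l^p. *)

Local Notation normc := Normc.normc.

(** * Inequalities for real sequences *)

Section RealSums.
Variable R : realType.
Implicit Types (x y w : nat -> R) (q s p : R).

Lemma geom_sum_le (r : R) n : 0 <= r < 1 -> \sum_(j < n) r ^+ j <= (1 - r)^-1.
Proof.
move=> /andP[r0 r1]; have r1' : 0 < 1 - r by rewrite subr_gt0.
rewrite -[leRHS]mul1r ler_pdivlMr// mulrC -(opprB r 1) mulNr -subrX1 opprB.
by rewrite gerBl exprn_ge0.
Qed.

Lemma one_powR s : 1 `^ s = 1 :> R.
Proof. by rewrite powR1. Qed.

Lemma le_powR2r p (a b : R) : 0 <= p -> 0 <= a -> a <= b -> a `^ p <= b `^ p.
Proof.
by move=> p0 a0 ab; rewrite ge0_ler_powR ?nnegrE//; exact: le_trans ab.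
Qed.

Lemma powR_half_lt1 s : 0 < s -> 0 <= (2^-1 : R) `^ s < 1.
Proof.
move=> s0; rewrite powR_ge0 /= -[ltRHS](one_powR s) gt0_ltr_powR//;
  by rewrite ?nnegrE ?invr_ge0 ?invf_lt1 ?ltr1n.
Qed.

Lemma powR_exprn (a s : R) n : 0 <= a -> (a ^+ n) `^ s = (a `^ s) ^+ n.
Proof.
move=> a0; elim: n => [|n IH]; first by rewrite !expr0 powR1.
by rewrite !exprS powRM ?IH// exprn_ge0.
Qed.

(** Once the levels above [z] are discarded, the rest form a geometric progression whose largest
    term is at most [z]; hence a constant free of [M] and [J]. *)
Lemma layer_sum_le s (M z : R) J : 0 < s -> 0 <= M -> 0 <= z ->
  \sum_(j < J | M / 2 ^+ j <= z) (M / 2 ^+ j) `^ s <=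
  (1 - 2^-1 `^ s)^-1 * z `^ s.
Proof.
move=> s0 + z0; have [r0 r1] := andP (powR_half_lt1 s0).
have C0 : 0 <= (1 - 2^-1 `^ s)^-1 by rewrite invr_ge0 subr_ge0 ltW.
elim: J M => [|J IH] M M0; first by rewrite big_ord0 mulr_ge0 ?powR_ge0.
have [Mz|zM] := leP M z.
  apply: (@le_trans _ _ (\sum_(j < J.+1) (M / 2 ^+ j) `^ s)).
    rewrite big_mkcond; apply: ler_sum => j _.
    by case: ifP => // _; rewrite powR_ge0.
  apply: (@le_trans _ _ (\sum_(j < J.+1) (M `^ s * (2^-1 `^ s) ^+ j))).
    apply: ler_sum => j _.
    by rewrite powRM ?invr_ge0 ?exprn_ge0// -exprVn powR_exprn// invr_ge0.
  rewrite -mulr_sumr mulrC ler_pM ?powR_ge0 ?sumr_ge0//.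
  - by apply: geom_sum_le; rewrite r0.
  - by rewrite ge0_ler_powR ?nnegrE// ltW.
rewrite big_mkcond big_ord_recl /= expr0 divr1 (lt_geF zM) add0r.
have := IH (M / 2) ltac:(by rewrite mulr_ge0).
rewrite big_mkcond /=; congr (_ <= _); apply: eq_bigr => j _.
by rewrite /bump /= add1n exprS invfM mulrA.
Qed.

(** The largest level not exceeding [z] is at least [z / 2], so its single term already suffices. *)
Lemma layer_ge s (M z : R) J : 0 < s -> 0 < M -> z <= M ->
  M / 2 ^+ J <= z ->
  z `^ s <= 2 `^ s * \sum_(j < J.+1 | M / 2 ^+ j <= z) (M / 2 ^+ j) `^ s.
Proof.
move=> s0 + + .
elim: J M => [|J IH] M M0 zM Mz.
  rewrite expr0 divr1 in Mz; have -> : z = M by apply/le_anti; rewrite zM.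
  rewrite big_mkcond big_ord1/= expr0 divr1 lexx ler_peMl ?powR_ge0//.
  by rewrite -[leLHS](one_powR s); apply: le_powR2r; rewrite ?ler1n//; exact: ltW.
have z0 : 0 <= z by apply: le_trans Mz; rewrite divr_ge0 ?exprn_ge0// ltW.
rewrite big_mkcond big_ord_recl/= expr0 divr1.
have S0 : 0 <= \sum_(i < J.+1) (if M / 2 ^+ bump 0 i <= z then (M / 2 ^+ bump 0 i) `^ s else 0).
  by apply: sumr_ge0 => j _; case: ifP => // _; rewrite powR_ge0.
have [Mz'|zM'] := leP (M / 2) z.
  have [Mz''|_] := leP M z.
    apply: (@le_trans _ _ (2 `^ s * M `^ s)); last by rewrite ler_wpM2l ?powR_ge0// lerDl.
    rewrite -powRM//; [|exact: ltW].
    by apply: le_powR2r => //; [exact: ltW|lra].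
  rewrite big_ord_recl /= /bump /= addn0 expr1 Mz' add0r mulrDr.
  rewrite -[leLHS]addr0 lerD//.
    rewrite -powRM//; [|by apply: divr_ge0 => //; exact: ltW].
    by apply: le_powR2r => //; [exact: ltW|lra].
  rewrite mulr_ge0 ?powR_ge0//.
  by apply: sumr_ge0 => j _; case: ifP => // _; rewrite powR_ge0.
have := IH (M / 2) ltac:(by rewrite divr_gt0) (ltW zM').
rewrite -mulrA -invfM -exprS => /(_ Mz) /le_trans; apply.
rewrite ler_wpM2l ?powR_ge0//.
have -> : (M <= z) = false by apply/negbTE; rewrite -ltNge; lra.
rewrite add0r big_mkcond /=; apply: ler_sum => j _.
by rewrite /bump /= add1n exprS invfM mulrA.
Qed.

(* Chebyshev-type hypothesis on the distribution of [x] in terms of the tails of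
   [y]; summing it over dyadic levels [t] gives a strong-type bound since q > 1. *)
Lemma sum_powR_of_tails q (c D : R) : 1 < q -> 0 < c -> 0 <= D ->
  exists2 C : R, 0 <= C & forall x y w (S : R),
    (forall n, 0 <= x n) -> (forall n, 0 <= y n) -> (forall n, 0 <= w n) ->
    (forall K (t : R), 0 < t -> exists L, t * \sum_(n < K | t <= x n) 1 <=
       D * \sum_(i < L | c * t <= y i) w i * y i) ->
    (forall L, \sum_(i < L) w i * y i `^ q <= S) ->
    forall K, \sum_(n < K) x n `^ q <= C * S.
Proof.
move=> q1 c0 D0; have q10 : 0 < q - 1 by rewrite subr_gt0.
have q0 : 0 < q by lra.
pose G := (1 - 2^-1 `^ (q - 1))^-1 : R.
have G0 : 0 <= G.
  by rewrite invr_ge0 subr_ge0 ltW//; case/andP: (powR_half_lt1 q10).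
exists (2 `^ q * (D * (G * c^-1 `^ (q - 1)))).
  by rewrite !mulr_ge0 ?powR_ge0.
move=> x y w S x0 y0 w0 Hx Hy K.
(* The summand 1 keeps the top level positive even if all these [x n] vanish. *)
pose M := 1 + \sum_(n < K) x n.
have M0 : 0 < M by rewrite ltr_pwDl// sumr_ge0.
have xM (n : 'I_K) : x n <= M.
  by rewrite /M (bigD1 n)//= addrCA lerDl addr_ge0// sumr_ge0.
(* [layer_ge] needs a level below [x n]; levels are positive, so zero terms are set apart. *)
have [J HJ] : exists J, forall n : 'I_K, x n = 0 \/ M / 2 ^+ J <= x n.
  suff [J HJ] : exists J, forall n, (n < K)%N -> x n = 0 \/ M / 2 ^+ J <= x n.
    by exists J => n; apply: HJ.
  clear xM; clearbody M; elim: K => [|K' [J HJ]]; first by exists 0%N.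
  have [J' HJ'] : exists J', x K' = 0 \/ M / 2 ^+ J' <= x K'.
    have := x0 K'; rewrite le_eqVlt => /predU1P[<-|xK0]; first by exists 0%N; left.
    exists (Num.truncn (M / x K')); right.
    rewrite ler_pdivrMr ?exprn_gt0// mulrC -ler_pdivrMr//.
    have /ltW/le_trans -> // := truncnS_gt (M / x K').
    by rewrite -natrX ler_nat; apply: ltn_expl.
  exists (maxn J J') => n; rewrite ltnS leq_eqVlt => nK.
  have mono a b : (a <= b)%N -> M / 2 ^+ b <= M / 2 ^+ a.
    move=> ab; rewrite ler_pM2l// lef_pV2 ?posrE ?exprn_gt0//.
    by rewrite ler_eXn2l ?ltr1n.
  case/orP: nK => [/eqP->|nK].
    by case: HJ' => [|h]; [left|right; apply: le_trans h; apply/mono/leq_maxr].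
  by case: (HJ _ nK) => [|h]; [left|right; apply: le_trans h; apply/mono/leq_maxl].
pose t (j : nat) := M / 2 ^+ j.
have t0 j : 0 < t j by rewrite divr_gt0 ?exprn_gt0.
(* The cut-off in the hypothesis depends on [t]; only finitely many levels occur and the right side
   grows with the cut-off, so the largest one serves for all. *)
have [L HL] : exists L, forall j : 'I_J.+1, t j * \sum_(n < K | t j <= x n) 1 <=
       D * \sum_(i < L | c * t j <= y i) w i * y i.
  suff [L HL] : exists L, forall j, (j < J.+1)%N -> t j * \sum_(n < K | t j <= x n) 1 <=
       D * \sum_(i < L | c * t j <= y i) w i * y i.
    by exists L => j; apply: HL.
  elim: {HJ} J.+1 => [|J' [L HL]]; first by exists 0%N.
  have [L' HL'] := Hx K _ (t0 J').
  have mono j a b : (a <= b)%N -> D * \sum_(i < a | c * t j <= y i) w i * y i <=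
     D * \sum_(i < b | c * t j <= y i) w i * y i.
    move=> ab; rewrite ler_wpM2l// (big_ord_widen_cond b (fun i => c * t j <= y i) (fun i => w i * y i) ab).
    rewrite [leLHS]big_mkcond [leRHS]big_mkcond; apply: ler_sum => i _.
    case: ifP => [/andP[->]//|_]; case: ifP => // _; exact: mulr_ge0.
  exists (maxn L L') => j; rewrite ltnS leq_eqVlt => /orP[/eqP->|jJ].
    by apply: le_trans HL' _; apply/mono/leq_maxr.
  by apply: le_trans (HL _ jJ) _; apply/mono/leq_maxl.
apply: (@le_trans _ _ (\sum_(n < K) 2 `^ q * \sum_(j < J.+1 | t j <= x n) t j `^ q)).
  apply: ler_sum => n _; case: (HJ n) => [->|h]; last exact: layer_ge.
  by rewrite powR0 ?gt_eqF// mulr_ge0 ?powR_ge0// sumr_ge0// => j _; rewrite powR_ge0.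
rewrite -mulr_sumr -mulrA ler_wpM2l ?powR_ge0//.
under eq_bigr do rewrite big_mkcond /=.
rewrite exchange_big /=.
(* Splitting t^q as t^(q-1) * t frees the factor [t] that the tail hypothesis controls. *)
apply: (@le_trans _ _ (\sum_(j < J.+1) t j `^ (q - 1) * (D * \sum_(i < L | c * t j <= y i) w i * y i))).
  apply: ler_sum => j _; rewrite -big_mkcond /=.
  apply: le_trans (ler_wpM2l (powR_ge0 _ _) (HL j)).
  rewrite mulrA mulr_sumr; apply: ler_sum => n _.
  by rewrite mulr1 -{3}(powRr1 (ltW (t0 j))) -powRD ?subrK// gt_eqF// implybT.
(* After the exchange of sums each [y i] collects the levels below [y i / c] with the exponent
   [q - 1 > 0], as [layer_sum_le] requires. *)
apply: (@le_trans _ _ (D * \sum_(i < L) w i * y i * \sum_(j < J.+1 | t j <= y i / c) t j `^ (q - 1))).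
  under eq_bigr do rewrite mulrCA.
  rewrite -mulr_sumr ler_wpM2l//.
  under eq_bigr do rewrite big_mkcond mulr_sumr.
  rewrite exchange_big /=; apply: ler_sum => i _.
  rewrite mulr_sumr [leRHS]big_mkcond; apply: ler_sum => j _ /=.
  rewrite ler_pdivlMr// [t j * c]mulrC.
  by case: ifP => _; rewrite ?mulr0// mulrC.
rewrite -mulrA ler_wpM2l// -mulrA.
apply: (@le_trans _ _ (\sum_(i < L) G * c^-1 `^ (q - 1) * (w i * y i `^ q))).
  apply: ler_sum => i _.
  apply: (@le_trans _ _ (w i * y i * (G * (y i / c) `^ (q - 1)))).
    apply: ler_wpM2l; first exact: mulr_ge0.
    apply: layer_sum_le => //; first exact: ltW.
    by apply: divr_ge0 => //; exact: ltW.
  rewrite powRM//; [|by rewrite invr_ge0; exact: ltW].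
  have -> : y i `^ q = y i * y i `^ (q - 1).
    rewrite -{2}(powRr1 (y0 i)) -powRD addrC subrK ?(gt_eqF q0)//.

  rewrite le_eqVlt; apply/orP; left; apply/eqP; ring.
by rewrite -mulr_sumr mulrA ler_wpM2l ?mulr_ge0 ?powR_ge0.
Qed.


(** In truncated subtraction [n - k + (k - n)] is |n - k|. The indices on either side of [n]
    contribute one geometric sum each. *)
Lemma sum_geom_dist (r : R) n N : 0 <= r < 1 ->
  \sum_(k < N) r ^+ (n - k + (k - n)) <= 2 / (1 - r).
Proof.
move=> r01; have [r0 r1] := andP r01.
have G0 : 0 <= (1 - r)^-1 by rewrite invr_ge0 subr_ge0 ltW.
suff : \sum_(k < N) r ^+ (n - k + (k - n)) <= \sum_(j < n) r ^+ j.+1 + (1 - r)^-1.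
  move=> /le_trans; apply; rewrite mulr_natl mulr2n lerD2r.
  apply: le_trans (geom_sum_le n r01); apply: ler_sum => j _.
  by rewrite exprS ler_piMl ?exprn_ge0// ltW.
elim: n N => [|n IH] [|N].
- by rewrite !big_ord0 add0r.
- rewrite [X in _ <= X + _]big_ord0 add0r.
  by under eq_bigr do rewrite sub0n subn0 add0n; exact: geom_sum_le.
- by rewrite big_ord0 addr_ge0// sumr_ge0// => j _; rewrite exprn_ge0.
rewrite big_ord_recl /= big_ord_recr /= addn0 subn0 -addrA addrCA lerD2l.
apply: le_trans (IH N); apply: ler_sum => k _.
by rewrite /bump /= add1n subSS.
Qed.

(* A geometrically weighted sum is controlled by its largest term once half of the
   weight is given up, which works for every exponent p > 0. *)
Lemma geometric_convolution p (r : R) : 0 < p -> 0 <= r < 1 ->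
  exists2 C : R, 0 <= C & forall x N, (forall n, 0 <= x n) ->
    \sum_(n < N) (\sum_(k < N) r ^+ (n - k + (k - n)) * x k) `^ p <=
    C * \sum_(k < N) x k `^ p.
Proof.
move=> p0 /andP[r0 r1]; pose s := Num.sqrt r.
have s0 : 0 <= s by apply: sqrtr_ge0.
have s1 : s < 1 by rewrite -sqrtr1 ltr_sqrt.
have s01 : 0 <= s < 1 by rewrite s0.
have ss : r = s * s by rewrite -expr2 sqr_sqrtr.
pose D := 2 / (1 - s).
have D0 : 0 <= D by rewrite divr_ge0// subr_ge0 ltW.
have sp : 0 <= s `^ p < 1.
  by rewrite powR_ge0 /= -[ltRHS](one_powR p) gt0_ltr_powR ?nnegrE.
exists (D `^ p * (2 / (1 - s `^ p))).
  rewrite mulr_ge0 ?powR_ge0// divr_ge0// subr_ge0 ltW//; by case/andP: sp.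
move=> x N x0.
pose d (n k : nat) := (n - k + (k - n))%N.
have max_le (n : 'I_N) : (\sum_(k < N) r ^+ d n k * x k) `^ p <=
    D `^ p * \sum_(k < N) (s `^ p) ^+ d n k * x k `^ p.
  pose F (k : 'I_N) := s ^+ d n k * x k.
  have F0 k : 0 <= F k by rewrite mulr_ge0 ?exprn_ge0.
  pose k0 := [arg max_(k > n) F k]%O.
  have Fk0 k : F k <= F k0 by rewrite /k0; case: arg_maxP => // i _; apply.
  apply: (@le_trans _ _ ((D * F k0) `^ p)).
    apply: le_powR2r; first exact: ltW.
      by apply: sumr_ge0 => k _; rewrite mulr_ge0// exprn_ge0.
    apply: (@le_trans _ _ (\sum_(k < N) s ^+ d n k * F k0)).
      apply: ler_sum => k _; rewrite ss exprMn -mulrA.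
      by rewrite ler_wpM2l ?exprn_ge0//; exact: Fk0.
    by rewrite -mulr_suml ler_wpM2r// sum_geom_dist.
  rewrite powRM// ler_wpM2l ?powR_ge0//.
  rewrite (bigD1 k0)//= /F powRM ?exprn_ge0// powR_exprn// lerDl.
  by apply: sumr_ge0 => k _; rewrite mulr_ge0 ?exprn_ge0 ?powR_ge0.
apply: le_trans (ler_sum _ (fun n _ => max_le n)) _.
rewrite -mulr_sumr -mulrA ler_wpM2l ?powR_ge0// exchange_big /= mulr_sumr.
apply: ler_sum => k _; rewrite -mulr_suml ler_wpM2r ?powR_ge0//.
apply: le_trans (sum_geom_dist k N sp); rewrite le_eqVlt; apply/orP; left; apply/eqP.
by apply: eq_bigr => n _; rewrite /d addnC.
Qed.

(** Lagrange's identity: twice the defect is the double sum of the squares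
    [(a i * b j - a j * b i) ^+ 2]. *)
Lemma sum_CauchySchwarz (I : Type) (l : seq I) (P : pred I) (a b : I -> R) :
  (\sum_(i <- l | P i) a i * b i) ^+ 2 <=
  (\sum_(i <- l | P i) a i ^+ 2) * \sum_(i <- l | P i) b i ^+ 2.
Proof.
rewrite -(ler_pM2l (ltr0n R 2)) -subr_ge0.
suff -> : 2 * ((\sum_(i <- l | P i) a i ^+ 2) * (\sum_(i <- l | P i) b i ^+ 2)) -
   2 * (\sum_(i <- l | P i) a i * b i) ^+ 2 =
   \sum_(i <- l | P i) \sum_(j <- l | P j) (a i * b j - a j * b i) ^+ 2.
  by apply: sumr_ge0 => i _; apply: sumr_ge0 => j _; rewrite sqr_ge0.
have -> : \sum_(i <- l | P i) \sum_(j <- l | P j) (a i * b j - a j * b i) ^+ 2 =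
  \sum_(i <- l | P i) \sum_(j <- l | P j) (a i ^+ 2 * b j ^+ 2) +
  \sum_(i <- l | P i) \sum_(j <- l | P j) (a j ^+ 2 * b i ^+ 2) -
  2 * \sum_(i <- l | P i) \sum_(j <- l | P j) (a i * b i * (a j * b j)).
  rewrite mulr_sumr -big_split -sumrB /=; apply: eq_bigr => i _.
  rewrite mulr_sumr -big_split -sumrB /=; apply: eq_bigr => j _; ring.
rewrite [X in _ + X - _]exchange_big /= expr2 !big_distrlr /=; ring.
Qed.

(** Fibres of a monotone map are intervals; [sigma f] is the first point of the fibre over [f]. *)
Lemma monotone_fibers (Phi : nat -> nat) lo hi :
  {in [pred k | (lo <= k < hi)%N] &, {homo Phi : a b / (a <= b)%N}} ->
  exists sigma : nat -> nat, forall k, (lo <= k < hi)%N ->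
    [/\ (lo <= sigma (Phi k) <= k)%N, Phi (sigma (Phi k)) = Phi k &
        forall j, (sigma (Phi k) <= j <= k)%N -> Phi j = Phi k].
Proof.
move=> mono.
exists (fun f => find (fun j => (lo <= j)%N && (Phi j == f)) (iota 0 hi)).
move=> k /andP[lok khi]; set p := (fun j => _).
have hasp : has p (iota 0 hi).
  by apply/hasP; exists k; rewrite ?mem_iota ?add0n //= /p lok eqxx.
have fhi : (find p (iota 0 hi) < hi)%N by rewrite has_find size_iota in hasp.
have := nth_find 0%N hasp; rewrite nth_iota// add0n /p => /andP[lof /eqP Pf].
have fk : (find p (iota 0 hi) <= k)%N.
  rewrite leqNgt; apply/negP => kf.
  by have := before_find 0%N kf; rewrite nth_iota// add0n /p lok eqxx.
split => //; first by rewrite lof.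
move=> j /andP[fj jk]; apply/eqP; rewrite eqn_leq.
rewrite (mono j k) ?inE// ?(leq_trans lof fj) ?lok ?(leq_ltn_trans jk)//=.
rewrite -{1}Pf mono ?inE// ?(leq_trans lof fj) ?(leq_ltn_trans jk)//.
by rewrite lof fhi.
Qed.

Lemma truncn_eq_dist (u v : R) : 0 <= u -> 0 <= v ->
  Num.truncn u = Num.truncn v -> u - v <= 1.
Proof.
move=> u0 v0 uv; have := truncnS_gt u; have := truncn_le v; rewrite v0 uv.
rewrite -natr1; lra.
Qed.

(* Cut the block where the cumulated mass or the cumulated length crosses a multiple
   of 1/m of its total: this makes at most 2m+1 cells, and apart from its first point
   each cell carries at most a fraction 1/m of the mass and of the length. *)
Lemma block_cells (a : nat -> R) lo hi (l : R) (m : nat) :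
  (forall k, 0 <= a k) -> 0 < \sum_(lo <= j < hi) a j ->
  (hi - lo)%:R <= l -> (0 < m)%N ->
  exists Phi sigma : nat -> nat,
    (forall k, (lo <= k < hi)%N -> (Phi k < m.*2.+1)%N /\ (sigma (Phi k) <= k)%N) /\
    forall x, (forall j, 0 <= x j) ->
    \sum_(lo <= k < hi) a k * (\sum_((sigma (Phi k)).+1 <= j < k.+1) x j) ^+ 2 <=
    l * (\sum_(lo <= j < hi) a j) / m%:R ^+ 2 * \sum_(lo <= j < hi) x j ^+ 2.
Proof.
move=> a0 A0 hl m0; set A := \sum_(lo <= j < hi) a j.
have mR : 0 < m%:R :> R by rewrite ltr0n.
have l0 : 0 < l.
  apply: lt_le_trans hl; rewrite ltr0n subn_gt0 ltnNge; apply/negP => hilo.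
  by move: A0; rewrite big_geq// ltxx.
pose mu k := \sum_(lo <= j < k.+1) a j.
have mu0 k : 0 <= mu k by apply: sumr_ge0.
have mu_cat v k : (lo <= v.+1)%N -> (v <= k)%N -> mu k = mu v + \sum_(v.+1 <= j < k.+1) a j.
  by move=> lov vk; rewrite /mu (@big_cat_nat _ _ _ v.+1).
(* Cumulated mass and length in units of 1/m of [A] and of [l]: a cell ends when either one passes
   an integer. *)
pose u k := m%:R * mu k / A; pose w (k : nat) := m%:R * (k - lo)%:R / l.
have u0 k : 0 <= u k by rewrite divr_ge0 ?mulr_ge0// ltW.
have w0 k : 0 <= w k by rewrite divr_ge0 ?mulr_ge0// ltW.
have u_mono i j : (lo <= i)%N -> (i <= j)%N -> u i <= u j.
  move=> loi ij; rewrite ler_pM2r ?invr_gt0// ler_pM2l//.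
  by rewrite (mu_cat i j) ?leqW// lerDl sumr_ge0.
have w_mono i j : (i <= j)%N -> w i <= w j.
  move=> ij; rewrite ler_pM2r ?invr_gt0// ler_pM2l// ler_nat.
  exact: leq_sub2r.
pose Phi k := (Num.truncn (u k) + Num.truncn (w k))%N.
have Phi_mono : {in [pred k | (lo <= k < hi)%N] &, {homo Phi : i j / (i <= j)%N}}.
  move=> i j; rewrite !inE => /andP[loi _] _ ij.
  by rewrite leq_add// le_truncn// ?u_mono// w_mono.
(* Two nondecreasing integers whose sum is unchanged are both unchanged, so the single label [Phi]
   records both kinds of cut. *)
have Phi_inj i j : (lo <= i)%N -> (i <= j)%N -> Phi i = Phi j ->
    u j - u i <= 1 /\ w j - w i <= 1.
  move=> loi ij eqP.
  have h1 : (Num.truncn (u i) <= Num.truncn (u j))%N by rewrite le_truncn// u_mono.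
  have h2 : (Num.truncn (w i) <= Num.truncn (w j))%N by rewrite le_truncn// w_mono.
  by split; apply: truncn_eq_dist => //; move: eqP; rewrite /Phi; lia.
have [sigma Hs] := monotone_fibers Phi_mono.
exists Phi, sigma; split.
  move=> k klh; have [/andP[_ ->] _ _] := Hs k klh; split => //.
  have /andP[lok khi] := klh.
  rewrite ltnS -addnn leq_add// -(ler_nat R) -[leRHS]mulr1.
    apply: (le_trans (y := u k)); first by rewrite truncn_le.
    rewrite /u -mulrA ler_pM2l// ler_pdivrMr// mul1r /A.
    by rewrite (@big_cat_nat _ _ _ k.+1 lo hi) ?leqW//= lerDl sumr_ge0.
  apply: (le_trans (y := w k)); first by rewrite truncn_le.
  rewrite /w -mulrA ler_pM2l// ler_pdivrMr// mul1r (le_trans _ hl)// ler_nat.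
  by rewrite leq_sub2r// ltnW.
move=> x x0.
(* The condition [sigma (Phi k) < k] leaves out the first point of the cell, which may be heavy;
   over the rest of the cell [u] increases by at most 1. *)
have cell_mass f K : (K <= hi)%N ->
    \sum_(lo <= k < K | (sigma (Phi k) < k)%N && (Phi k == f)) a k <= A / m%:R.
  elim: K => [|K IH] Khi; first by rewrite big_geq// divr_ge0// ltW.
  have [loK|Klo] := leqP lo K; last by rewrite big_geq// divr_ge0// ltW.
  rewrite big_mkcond big_nat_recr//= -big_mkcond /=.
  case: ifP => [/andP[sK /eqP PK]|_]; last by rewrite addr0; apply: IH; exact: ltnW.
  have KB : (lo <= K < hi)%N by rewrite loK.
  have [/andP[los _] Ps _] := Hs K KB.
  apply: (@le_trans _ _ (\sum_((sigma (Phi K)).+1 <= k < K.+1) a k)).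
    rewrite [leRHS]big_nat_recr//= lerD2r.
    rewrite (@big_cat_nat _ _ _ (sigma (Phi K)).+1 lo K) ?leqW//=.
    rewrite big1_seq ?add0r; last first.
      move=> k /andP[/andP[sk /eqP Pk]]; rewrite mem_index_iota => /andP[_].
      by rewrite ltnS PK -Pk leqNgt sk.
    rewrite big_mkcond; apply: ler_sum => k _; by case: ifP.
  have [+ _] := Phi_inj _ _ los (ltnW sK) Ps.
  rewrite /u -mulrBl -mulrBr (mu_cat (sigma (Phi K)) K) ?leqW// ?(ltnW sK)// addrC addKr.
  by rewrite ler_pdivrMr// mul1r mulrC -ler_pdivlMr.
(* Cauchy-Schwarz on a stretch of length at most [l / m]. Once the sums are exchanged, each [j]
   meets only the [k] of its own cell, whose mass [cell_mass] bounds. *)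
apply: (@le_trans _ _ (\sum_(lo <= k < hi) \sum_(lo <= j < hi)
   if (sigma (Phi k) < k)%N && (Phi k == Phi j) then a k * (l / m%:R * x j ^+ 2) else 0)).
  rewrite [leLHS]big_nat [leRHS]big_nat; apply: ler_sum => k klh.
  have [/andP[los sk] Ps Pbetween] := Hs k klh.
  move: sk; rewrite leq_eqVlt => /orP[/eqP sk|sk].
    rewrite sk big_geq// expr0n mulr0; apply: sumr_ge0 => j _.
    by rewrite ltnn.
  apply: (@le_trans _ _ (a k * (l / m%:R * \sum_((sigma (Phi k)).+1 <= j < k.+1) x j ^+ 2))).
    rewrite ler_wpM2l//.
    have := sum_CauchySchwarz (index_iota (sigma (Phi k)).+1 k.+1) xpredT (fun=> 1) x.
    under eq_bigr do rewrite mul1r.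
    move=> /le_trans; apply; rewrite ler_wpM2r ?sumr_ge0//.
      by move=> i _; rewrite sqr_ge0.
    under eq_bigr do rewrite expr1n.
    rewrite sumr_const_nat subSS.
    have [_] := Phi_inj _ _ los (ltnW sk) Ps.
    rewrite /w -mulrBl -mulrBr ler_pdivrMr// mul1r mulrC -ler_pdivlMr//.
    have lok : (lo <= k)%N by case/andP: klh.
    suff <- : (k - sigma (Phi k))%:R = (k - lo)%:R - (sigma (Phi k) - lo)%:R :> R by [].
    by rewrite -natrB; [congr _%:R; lia|lia].
  rewrite mulrA [a k * _]mulrC -mulrA !mulr_sumr.
  rewrite (@big_cat_nat _ _ _ (sigma (Phi k)).+1 lo hi) ?leqW//=; last first.
    by case/andP: klh => _; exact: ltn_trans.
  rewrite -[leLHS]add0r lerD//.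
    by apply: sumr_ge0 => j _; case: ifP => // _; rewrite !mulr_ge0// ?invr_ge0 ?sqr_ge0// ltW.
  rewrite (@big_cat_nat _ _ _ k.+1 (sigma (Phi k)).+1 hi)//=; last 2 first.
  - by rewrite ltnS ltnW.
  - by case/andP: klh.
  rewrite -[leLHS]addr0 lerD//; last first.
    by apply: sumr_ge0 => j _; case: ifP => // _; rewrite !mulr_ge0// ?invr_ge0 ?sqr_ge0// ltW.
  rewrite [leLHS]big_nat [leRHS]big_nat; apply: ler_sum => j /andP[sj jk].
  rewrite sk (Pbetween j) ?eqxx/=; last by rewrite (ltnW sj) -ltnS.
  by rewrite le_eqVlt; apply/orP; left; apply/eqP; ring.
rewrite exchange_big /=.
apply: (@le_trans _ _ (\sum_(lo <= j < hi) (A / m%:R * (l / m%:R * x j ^+ 2)))).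
  apply: ler_sum => j _; rewrite -big_mkcond /= -mulr_suml.
  rewrite ler_wpM2r ?mulr_ge0 ?invr_ge0 ?sqr_ge0 ?(ltW l0)//.
  exact: cell_mass.
rewrite -!mulr_sumr le_eqVlt; apply/orP; left; apply/eqP.
by field; rewrite pnatr_eq0 -lt0n.
Qed.

End RealSums.

(** * Sequence spaces and approximation numbers *)

Section SequenceSpaces.
Variable R : realType.
Local Notation C := R[i].
Implicit Types (f g : seqC R) (T P : seqC R -> seqC R).

Lemma normcE_C (z : C) : `|z| = (normc z)%:C%C.
Proof. by case: z. Qed.

Lemma normc_real (x : R) : normc (x%:C)%C = `|x|.
Proof. by rewrite /= expr0n addr0 sqrtr_sqr. Qed.

Lemma normc_ge0 (z : C) : 0 <= normc z.
Proof. by case: z => a b; exact: sqrtr_ge0. Qed.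

Lemma normc_sum_le (I : Type) (l : seq I) (Q : pred I) (F : I -> C) :
  normc (\sum_(i <- l | Q i) F i) <= \sum_(i <- l | Q i) normc (F i).
Proof.
elim/big_ind2 : _ => //; first by rewrite Normc.normc0.
by move=> a b c d ab cd; apply: (le_trans (le_normcD _ _)); exact: lerD.
Qed.

Lemma normc_opp (z : C) : normc (- z) = normc z.
Proof. by apply: complexI; rewrite -!normcE_C normrN. Qed.

Lemma normc_sqr (z : C) : (normc z) ^+ 2 = complex.Re z ^+ 2 + complex.Im z ^+ 2.
Proof. by case: z => a b /=; rewrite sqr_sqrtr// addr_ge0 ?sqr_ge0. Qed.

Lemma nneseries_leP (u : nat -> R) (S : R) : (forall n, 0 <= u n) ->
  (\sum_(0 <= n <oo) (u n)%:E <= S%:E)%E <-> forall N, \sum_(n < N) u n <= S.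
Proof.
move=> u0; split=> [h N|h].
  rewrite -lee_fin; apply: le_trans h; rewrite -(big_mkord xpredT) -sumEFin.
  by apply: nneseries_lim_ge => n _ _; rewrite lee_fin.
apply: lime_le; first by apply: is_cvg_nneseries => n _ _; rewrite lee_fin.
by apply: nearW => N; rewrite sumEFin lee_fin big_mkord.
Qed.

Lemma nneseries_ltyP (u : nat -> R) : (forall n, 0 <= u n) ->
  (\sum_(0 <= n <oo) (u n)%:E < +oo)%E <-> exists S, forall N, \sum_(n < N) u n <= S.
Proof.
move=> u0; split=> [h|[S h]]; last first.
  by apply: (@le_lt_trans _ _ S%:E); [exact/nneseries_leP|exact: ltry].
have h0 : (0 <= \sum_(0 <= n <oo) (u n)%:E)%E.
  by apply: nneseries_ge0 => n _ _; rewrite lee_fin.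
exists (fine (\sum_(0 <= n <oo) (u n)%:E)%E); apply/nneseries_leP => //.
by rewrite fineK// ge0_fin_numE.
Qed.

Lemma l2sq_leP f (S : R) :
  (l2sq f <= S%:E)%E <-> forall N, \sum_(n < N) normc (f n) ^+ 2 <= S.
Proof. by apply: nneseries_leP => n; rewrite sqr_ge0. Qed.

Lemma in_l2P f :
  in_l2 f <-> exists S, forall N, \sum_(n < N) normc (f n) ^+ 2 <= S.
Proof. by apply: nneseries_ltyP => n; rewrite sqr_ge0. Qed.

(** A finite bound rules out the default value [+oo] of [opnorm], so it already contains the fact
    that [T f] is in l^2. *)
Lemma opnorm_leP T (M : R) : 0 <= M ->
  (opnorm T <= M%:E)%E <->
  forall f, (l2sq f <= 1)%E -> forall N, \sum_(n < N) normc (T f n) ^+ 2 <= M ^+ 2.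
Proof.
move=> M0; split=> [h f f1|h].
  apply/l2sq_leP; apply: contrapT => /negP; rewrite -ltNge => hf.
  have : (~ (opnorm T <= M%:E)%E); last by [].
  apply/negP; rewrite -ltNge.
  apply: (@lt_le_trans _ _ (if l2sq (T f) is (x%:E)%E then (Num.sqrt x)%:E else +oo)%E).
    move: hf; case: (l2sq (T f)) => [x| |] //.
    - rewrite !lte_fin => hx; rewrite -(ger0_norm M0) -sqrtr_sqr ltr_sqrt//.
      by apply: le_lt_trans hx; rewrite sqr_ge0.
    - by move=> _; rewrite ltry.
  apply: ereal_sup_ubound; exists f => //; split => //.
  by apply: le_lt_trans f1 _; rewrite ltry.
apply: ge_ereal_sup => _ [f [_ f1] <-].
have /l2sq_leP := h f f1.
have : (0 <= l2sq (T f))%E by apply: nneseries_ge0 => n _ _; rewrite lee_fin sqr_ge0.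
case: (l2sq (T f)) => [x| |]//; rewrite !lee_fin => x0 xM.
by rewrite -(ger0_norm M0) -sqrtr_sqr ler_sqrt// sqr_ge0.
Qed.

Lemma opnorm_ge0 T : (0 <= opnorm T)%E.
Proof.
pose f0 : seqC R := fun=> 0.
have l0 : l2sq f0 = 0%E.
  by apply: eseries0 => n _ _; rewrite /f0 Normc.normc0 expr0n.
apply: (@le_trans _ _ (if l2sq (T f0) is (x%:E)%E then (Num.sqrt x)%:E else +oo)%E).
  by case: (l2sq (T f0)) => [x| |]; rewrite ?lee_fin ?sqrtr_ge0 ?leey.
apply: ereal_sup_ubound; exists f0 => //; rewrite /in_l2 /= l0.
by rewrite ltry lee_fin ler01.
Qed.

Lemma approx_num_ge0 T n : (0 <= approx_num T n)%E.
Proof. by apply: le_ereal_inf_tmp => _ [P _ <-]; exact: opnorm_ge0. Qed.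

Lemma in_l20 : in_l2 ((fun=> 0) : seqC R).
Proof.
by apply/in_l2P; exists 0 => N; rewrite big1// => j _; rewrite Normc.normc0 expr0n.
Qed.

Lemma in_l2_lin (a : C) f g : in_l2 f -> in_l2 g -> in_l2 (fun k => a * f k + g k).
Proof.
move=> /in_l2P[S HS] /in_l2P[U HU]; apply/in_l2P.
exists (2 * (normc a ^+ 2 * S) + 2 * U) => N.
apply: (@le_trans _ _ (\sum_(k < N) (2 * (normc a ^+ 2 * normc (f k) ^+ 2) + 2 * normc (g k) ^+ 2))).
  apply: ler_sum => k _.
  have h := le_normcD (a * f k) (g k); rewrite Normc.normcM in h.
  apply: (@le_trans _ _ ((normc a * normc (f k) + normc (g k)) ^+ 2)).
    by rewrite ler_pXn2r ?nnegrE ?addr_ge0 ?mulr_ge0 ?normc_ge0.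
  have := sqr_ge0 (normc a * normc (f k) - normc (g k)).
  rewrite -subr_ge0 => ?; nra.
by rewrite big_split /= -!mulr_sumr lerD ?ler_wpM2l ?HU ?HS ?sqr_ge0.
Qed.

Lemma in_l2_sum n (c : 'I_n -> C) (v : 'I_n -> seqC R) :
  (forall i, in_l2 (v i)) -> in_l2 (fun k => \sum_(i < n) c i * v i k).
Proof.
elim: n c v => [|n IH] c v vl2.
  by rewrite (_ : (fun k => _) = fun=> 0); [exact: in_l20|apply: funext => k; rewrite big_ord0].
rewrite (_ : (fun k => _) = (fun k => c ord0 * v ord0 k + \sum_(i < n) c (lift ord0 i) * v (lift ord0 i) k)).
  by apply: in_l2_lin => //; apply: IH.
by apply: funext => k; rewrite big_ord_recl.
Qed.

Lemma rank_le0 n : rank_le ((fun _ _ => 0) : seqC R -> seqC R) n.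
Proof.
exists (fun=> fun=> 0); split=> [_|f _]; first exact: in_l20.
by exists (fun=> 0); apply: funext => k; rewrite big1// => i _; rewrite mul0r.
Qed.

Lemma rank_leD P Q a b : rank_le P a -> rank_le Q b ->
  rank_le (fun f k => P f k + Q f k) (a + b).
Proof.
move=> [v [vl2 Pv]] [w [wl2 Qw]].
exists (fun i => match fintype.split i with inl j => v j | inr j => w j end); split.
  by move=> i; case: fintype.split.
move=> f fl2; have [c Hc] := Pv f fl2; have [d Hd] := Qw f fl2.
exists (fun i => match fintype.split i with inl j => c j | inr j => d j end).
apply: funext => k; rewrite Hc Hd big_split_ord /=; congr (_ + _); apply: eq_bigr => i _.
- by rewrite (unsplitK (inl _ i)).
- by rewrite (unsplitK (inr _ i)).
Qed.

Lemma rank_le_mono P a b : (a <= b)%N -> rank_le P a -> rank_le P b.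
Proof.
move=> ab Pa; rewrite -(subnKC ab).
rewrite (_ : P = (fun f k => P f k + 0)); first exact/rank_leD/rank_le0.
by apply: funext => f; apply: funext => k; rewrite addr0.
Qed.

Lemma rank_le_sum L (P_ : nat -> seqC R -> seqC R) (r_ : nat -> nat) :
  (forall n, (n < L)%N -> rank_le (P_ n) (r_ n)) ->
  rank_le (fun f k => \sum_(n < L) P_ n f k) (\sum_(n < L) r_ n).
Proof.
elim: L => [|L IH] H.
  rewrite (_ : (fun f k => _) = fun _ _ => 0); first exact: rank_le0.
  by apply: funext => f; apply: funext => k; rewrite big_ord0.
rewrite big_ord_recr /= (_ : (fun f k => _) = (fun f k => (\sum_(n < L) P_ n f k) + P_ L f k)).
  by apply: rank_leD; [apply: IH => n nL; apply: H; exact: ltnW|exact: H].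
by apply: funext => f; apply: funext => k; rewrite big_ord_recr.
Qed.

Lemma rank_le_linear P n : rank_le P n ->
  (forall (a : C) f g, P (fun k => a * f k + g k) = (fun k => a * P f k + P g k)) ->
  linear_on_l2 P.
Proof.
move=> [v [vl2 Pv]] lin; split=> [f fl2|]; last by move=> a f g _ _; exact: lin.
by have [c ->] := Pv f fl2; exact: in_l2_sum.
Qed.

Lemma approx_num_le T P n (M : \bar R) : linear_on_l2 P -> rank_le P n ->
  (opnorm (fun f k => T f k - P f k)%R <= M)%E -> (approx_num T n <= M)%E.
Proof. by move=> lP rP; apply: le_trans; apply: ereal_inf_lbound; exists P. Qed.

Lemma approx_num_noninc T a b : (a <= b)%N -> (approx_num T b <= approx_num T a)%E.
Proof.
move=> ab; apply: le_ereal_inf_tmp => _ [P [lP rP] <-].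
by apply: (approx_num_le lP (rank_le_mono ab rP)).
Qed.

Lemma opnorm_le_approx_num0 T : (opnorm T <= approx_num T 0)%E.
Proof.
apply: le_ereal_inf_tmp => _ [P [lP [v [_ rP]]] <-].
apply: ge_ereal_sup => _ [f [fl2 f1] <-]; apply: ereal_sup_ubound; exists f => //.
have [c Hc] := rP f fl2.
suff -> : (fun k => T f k - P f k) = T f by [].
by apply: funext => k; rewrite Hc big_ord0 subr0.
Qed.

End SequenceSpaces.

(** * Dyadic blocks and the upper bound for approximation numbers *)

Section Blocks.
Variable R : realType.

(* Left endpoint of the block [I_n]; its right endpoint (excluded) is [dy n.+1 = 2 ^ n]. *)
Definition dy (n : nat) : nat := if n is m.+1 then 2 ^ m else 0.

Lemma dyS n : dy n.+1 = (2 ^ n)%N. Proof. by []. Qed.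

Lemma dy_mono a b : (a <= b)%N -> (dy a <= dy b)%N.
Proof.
by case: a b => [|a] [|b]//= ab; rewrite leq_exp2l.
Qed.

Lemma dy_length n : (dy n.+1 - dy n <= 2 ^ n)%N.
Proof. exact: leq_subr. Qed.

Lemma dy_block_inj n m k :
  (dy n <= k < dy n.+1)%N -> (dy m <= k < dy m.+1)%N -> n = m.
Proof.
move=> /andP[a b] /andP[c d]; apply/eqP; rewrite eqn_leq; apply/andP; split.
- by rewrite leqNgt; apply/negP => /dy_mono mn; move: (leq_trans d mn); lia.
- by rewrite leqNgt; apply/negP => /dy_mono mn; move: (leq_trans b mn); lia.
Qed.

Lemma sum_blocks (F : nat -> R) N :
  \sum_(0 <= k < dy N) F k = \sum_(n < N) \sum_(dy n <= k < dy n.+1) F k.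
Proof.
elim: N => [|N IH]; first by rewrite big_ord0 big_geq.
by rewrite (@big_cat_nat _ _ _ (dy N)) ?dy_mono//= IH big_ord_recr.
Qed.

Lemma sum_ord_le_blocks (F : nat -> R) K : (forall k, 0 <= F k) ->
  \sum_(k < K) F k <= \sum_(n < K.+1) \sum_(dy n <= k < dy n.+1) F k.
Proof.
move=> F0; rewrite -sum_blocks -(big_mkord xpredT) (@big_cat_nat _ _ _ K 0 (dy K.+1))//=.
  by rewrite lerDl sumr_ge0.
by rewrite ltnW// ltn_expl.
Qed.

(** Cauchy-Schwarz on [I_m] bounds the sum there by 2^(m/2) times the norm of [x] on [I_m]. After
    division by 2^(n/2), the sum up to 2^n is dominated by the convolution of these norms with the
    kernel of ratio 2^(-1/2). *)
Lemma dyadic_Hardy : exists2 C : R, 0 <= C & forall (x : nat -> R) N,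
  (forall j, 0 <= x j) ->
  \sum_(n < N) (\sum_(0 <= j < dy n.+1) x j) ^+ 2 / 2 ^+ n <=
  C * \sum_(0 <= j < dy N) x j ^+ 2.
Proof.
pose c : R := Num.sqrt 2; have c2 : c ^+ 2 = 2 by rewrite sqr_sqrtr.
have c0 : 0 < c by rewrite sqrtr_gt0.
have c1 : 1 < c by rewrite -sqrtr1 ltr_sqrt// ltr1n.
have r01 : 0 <= c^-1 < 1 by rewrite invr_ge0 ltW//= invf_lt1.
have [C C0 HC] := geometric_convolution (ltr0n R 2) r01.
exists C => // x N x0.
pose F m := Num.sqrt (\sum_(dy m <= j < dy m.+1) x j ^+ 2).
have F0 m : 0 <= F m by exact: sqrtr_ge0.
have F2 m : F m ^+ 2 = \sum_(dy m <= j < dy m.+1) x j ^+ 2.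
  by rewrite sqr_sqrtr// sumr_ge0// => j _; rewrite sqr_ge0.
have block m : \sum_(dy m <= j < dy m.+1) x j <= c ^+ m * F m.
  rewrite -(ler_pXn2r (ltn0Sn 1)) ?nnegrE ?sumr_ge0 ?mulr_ge0 ?exprn_ge0 ?(ltW c0)//.
  rewrite exprMn F2 -exprM mulnC exprM c2.
  have := sum_CauchySchwarz (index_iota (dy m) (dy m.+1)) xpredT (fun=> 1) x.
  under eq_bigr do rewrite mul1r.
  move=> /le_trans; apply; rewrite ler_wpM2r ?sumr_ge0//.
    by move=> i _; rewrite sqr_ge0.
  under eq_bigr do rewrite expr1n.
  by rewrite sumr_const_nat -natrX ler_nat; exact: dy_length.
rewrite sum_blocks; under [X in _ <= _ * X]eq_bigr do rewrite -F2.
have e2 (y : R) : 0 <= y -> y `^ 2%:R = y ^+ 2 by exact: powR_mulrn.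
under [X in _ <= _ * X]eq_bigr do rewrite -e2//.
apply: le_trans (HC F N F0); apply: ler_sum => n _.
rewrite e2; last first.
  by apply: sumr_ge0 => k _; rewrite mulr_ge0// exprn_ge0// invr_ge0 ltW.
rewrite ler_pdivrMr ?exprn_gt0// -c2 -exprM mulnC exprM -exprMn.
have S0 : 0 <= \sum_(k < N) c^-1 ^+ (n - k + (k - n)) * F k.
  by apply: sumr_ge0 => k _; rewrite mulr_ge0// exprn_ge0// invr_ge0 ltW.
rewrite ler_pXn2r ?nnegrE ?sumr_ge0 ?mulr_ge0 ?exprn_ge0 ?(ltW c0)//.
rewrite sum_blocks mulr_suml.
rewrite (big_ord_widen N (fun m => \sum_(dy m <= j < dy m.+1) x j)) ?ltn_ord//.
rewrite big_mkcond /=; apply: ler_sum => k _; case: ifPn => [kn|_].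
  apply: le_trans (block k) _.
  rewrite (_ : (k - n = 0)%N); last by apply/eqP; rewrite subn_eq0.
  rewrite addn0 mulrAC ler_wpM2r// exprVn.
  rewrite -{2}(subnK (kn : (k <= n)%N)) exprD mulKf// expf_neq0// gt_eqF//.
by rewrite !mulr_ge0// ?exprn_ge0 ?invr_ge0// ltW.
Qed.

End Blocks.

Section RhalyUpper.
Variable R : realType.
Local Notation C := R[i].
Variable alpha : seqC R.
Implicit Types (f g : seqC R).

Definition mass n : R := \sum_(dy n <= j < dy n.+1) normc (alpha j) ^+ 2.

Definition beta n : R := Num.sqrt (2 ^+ n * mass n).

Lemma mass_ge0 n : 0 <= mass n.
Proof. by apply: sumr_ge0 => j _; rewrite sqr_ge0. Qed.

Lemma beta_ge0 n : 0 <= beta n. Proof. exact: sqrtr_ge0. Qed.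

Lemma beta_sqr n : beta n ^+ 2 = 2 ^+ n * mass n.
Proof. by rewrite sqr_sqrtr// mulr_ge0 ?exprn_ge0 ?mass_ge0. Qed.

Hypothesis alpha_l2 : in_l2 alpha.

(* The values of [s] play the role of the cell boundaries. *)
Definition block_head n (s : nat -> nat) (f : seqC R) : seqC R := fun k =>
  if (dy n <= k < dy n.+1)%N then alpha k * \sum_(0 <= j < s k) f j else 0.

Lemma block_head_linear n s (a : C) f g :
  block_head n s (fun k => a * f k + g k) =
  (fun k => a * block_head n s f k + block_head n s g k).
Proof.
apply: funext => k; rewrite /block_head; case: ifP => _; last by rewrite mulr0 addr0.
by rewrite big_split /= -mulr_sumr mulrDr mulrCA.
Qed.

(** On each cell the head is one number times [alpha], so the image is spanned by the restrictions
    of [alpha] to the cells. *)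
Lemma block_head_approx n (t : R) : 0 < t -> t <= beta n ->
  exists s : nat -> nat,
  [/\ forall k, (dy n <= k < dy n.+1)%N -> (s k <= k.+1)%N,
      exists r : nat, r%:R <= 5 * (beta n / t) /\ rank_le (block_head n s) r &
      forall x : nat -> R, (forall j, 0 <= x j) ->
       \sum_(dy n <= k < dy n.+1) normc (alpha k) ^+ 2 *
          (\sum_(s k <= j < k.+1) x j) ^+ 2 <=
       t ^+ 2 * \sum_(dy n <= j < dy n.+1) x j ^+ 2].
Proof.
move=> t0 tb; have b0 : 0 < beta n by exact: lt_le_trans tb.
have A0 : 0 < mass n.
  have : 0 < beta n ^+ 2 by rewrite exprn_gt0.
  by rewrite beta_sqr pmulr_rgt0// exprn_gt0.
(* As [m > beta n / t], the error (beta_n / m)^2 is at most t^2; as [beta n / t >= 1], m is at most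
   twice this ratio, and the 2m + 1 cells number at most five times it. *)
pose m := (Num.truncn (beta n / t)).+1.
have bt0 : 0 <= beta n / t by rewrite divr_ge0// ltW.
have bt1 : 1 <= beta n / t by rewrite ler_pdivlMr// mul1r.
have mb : beta n / t < m%:R by exact: truncnS_gt.
have mb' : m%:R <= 2 * (beta n / t).
  by rewrite /m -natr1; have := truncn_le (beta n / t); rewrite bt0; lra.
have hl : (dy n.+1 - dy n)%:R <= 2 ^+ n :> R.
  by rewrite -natrX ler_nat; exact: dy_length.
have [Phi [sigma [Hs Hx]]] := @block_cells R (fun k => normc (alpha k) ^+ 2) (dy n) (dy n.+1)
  (2 ^+ n) m (fun k => sqr_ge0 _) A0 hl (ltn0Sn _).
(* The successor puts the first point of the cell into the head. *)
exists (fun k => (sigma (Phi k)).+1); split.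
- by move=> k /Hs[_]; rewrite ltnS.
- exists m.*2.+1; split.
    by rewrite -natr1 -muln2 natrM; lra.
  exists (fun (i : 'I_m.*2.+1) k =>
    if ((dy n <= k < dy n.+1)%N && (Phi k == i :> nat)) then alpha k else 0); split.
    move=> i; have /in_l2P[S HS] := alpha_l2; apply/in_l2P; exists S => N.
    apply: le_trans (HS N); apply: ler_sum => k _; case: ifP => // _.
    by rewrite Normc.normc0 expr0n sqr_ge0.
  move=> f _; exists (fun i : 'I_m.*2.+1 => \sum_(0 <= j < (sigma i).+1) f j).
  apply: funext => k; rewrite /block_head; case: ifP => [kb|_]; last first.
    by rewrite big1// => i _; rewrite mulr0.
  have [Pk _] := Hs k kb.
  rewrite (bigD1 (Ordinal Pk))//= eqxx [X in _ = _ + X]big1 ?addr0 1?mulrC// => i.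
  by rewrite -val_eqE /= eq_sym => /negbTE ->; rewrite mulr0.
move=> x x0; apply: (le_trans (Hx x x0)).
rewrite ler_wpM2r ?sumr_ge0//; first by move=> j _; rewrite sqr_ge0.
rewrite -/(mass n) -beta_sqr ler_pdivrMr ?exprn_gt0 ?ltr0n//.
rewrite -exprMn ler_pXn2r ?nnegrE ?mulr_ge0 ?(ltW t0) ?(ltW b0)//.
by rewrite mulrC -ler_pdivrMr// ltW.
Qed.

(* Rows in blocks with [beta n < t] are left untouched and handled by Hardy's inequality. *)
Lemma rhaly_approx_num : exists2 D : R, 0 < D &
  forall (t : R) L (r : nat), 0 < t -> (forall n, (L <= n)%N -> beta n < t) ->
  5 * (\sum_(n < L | t <= beta n) beta n / t) <= r%:R ->
  (approx_num (rhaly alpha) r <= (D * t)%:E)%E.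
Proof.
have [H H0 HH] := dyadic_Hardy R.
exists (1 + H); first by rewrite ltr_pwDl.
move=> t L r t0 HL Hr.
(* Blocks with [beta n < t] receive the cut 0 and the rank 0, so that one choice function covers all
   blocks. *)
have ex n : exists p : (nat -> nat) * nat,
  [/\ forall k, (dy n <= k < dy n.+1)%N -> (p.1 k <= k.+1)%N,
      beta n < t -> p.1 = fun=> 0%N, 
      p.2%:R <= (if t <= beta n then 5 * (beta n / t) else 0) /\ rank_le (block_head n p.1) p.2 &
      t <= beta n -> forall x : nat -> R, (forall j, 0 <= x j) ->
       \sum_(dy n <= k < dy n.+1) normc (alpha k) ^+ 2 *
          (\sum_(p.1 k <= j < k.+1) x j) ^+ 2 <=
       t ^+ 2 * \sum_(dy n <= j < dy n.+1) x j ^+ 2].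
  have [tb|bt] := leP t (beta n).
    have [s [s1 [rn [s2 s3]] s4]] := block_head_approx t0 tb.
    by exists (s, rn); split.
  exists ((fun=> 0%N), 0%N); split => //; split => //.
  rewrite (_ : block_head _ _ = fun _ _ => 0); first exact: rank_le0.
  apply: funext => f; apply: funext => k; rewrite /block_head big_geq// mulr0.
  by case: ifP.
have [p Hp] := choice ex.
pose P f k := \sum_(n < L) block_head n (p n).1 f k.
have rP : rank_le P (\sum_(n < L) (p n).2).
  by apply: (@rank_le_sum R L (fun n => block_head n (p n).1) (fun n => (p n).2)) => n _; have [_ _ []] := Hp n.
have rr : (\sum_(n < L) (p n).2 <= r)%N.
  rewrite -(ler_nat R); apply: le_trans Hr; rewrite natr_sum mulr_sumr big_mkcond.
  rewrite [leRHS]big_mkcond /=.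
  by apply: ler_sum => n _; have [_ _ [+ _] _] := Hp n.
have lP : linear_on_l2 P.
  apply: (rank_le_linear rP) => a f g; apply: funext => k; rewrite /P.
  under eq_bigr do rewrite block_head_linear.
  by rewrite big_split /= -mulr_sumr.
apply: (approx_num_le lP (rank_le_mono rr rP)).
apply/opnorm_leP; first by rewrite mulr_ge0// ?addr_ge0// ltW.
move=> f f1 N.
pose x j := normc (f j).
have x0 j : 0 <= x j by exact: normc_ge0.
have res n k : (dy n <= k < dy n.+1)%N ->
    normc (rhaly alpha f k - P f k) ^+ 2 <=
    normc (alpha k) ^+ 2 * (\sum_((p n).1 k <= j < k.+1) x j) ^+ 2.
  move=> kn.
  have -> : P f k = alpha k * \sum_(0 <= j < (p n).1 k) f j.
    have [nL|Ln] := ltnP n L.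
      rewrite /P (bigD1 (Ordinal nL))//= big1 ?addr0; last first.
        move=> i; rewrite -val_eqE /= /block_head; case: ifP => // kin.
        by rewrite (dy_block_inj kin kn) eqxx.
      by rewrite /block_head kn.
    have [_ -> //] := Hp n; last exact: HL.
    rewrite big_geq// mulr0 /P big1// => i _; rewrite /block_head; case: ifP => // kin.
    by have := ltn_ord i; rewrite (dy_block_inj kin kn) ltnNge Ln.
  rewrite /rhaly -mulrBr (@big_cat_nat _ _ _ ((p n).1 k) 0 k.+1)//=; last first.
    by have [+ _ _ _] := Hp n; exact.
  rewrite addrAC subrr add0r Normc.normcM exprMn ler_wpM2l ?sqr_ge0//.
  by rewrite ler_pXn2r ?nnegrE ?sumr_ge0 ?normc_ge0// normc_sum_le.
apply: (le_trans (@sum_ord_le_blocks R (fun k => normc (rhaly alpha f k - P f k) ^+ 2) N _)).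
  by move=> k; rewrite sqr_ge0.
(* The first term pays for the blocks that were cut; on the others [mass n <= t ^+ 2 / 2 ^+ n]
   leaves the Hardy term. *)
apply: (@le_trans _ _ (\sum_(n < N.+1) t ^+ 2 *
   ((\sum_(dy n <= j < dy n.+1) x j ^+ 2) + (\sum_(0 <= j < dy n.+1) x j) ^+ 2 / 2 ^+ n))).
  apply: ler_sum => n _.
  apply: (@le_trans _ _ (\sum_(dy n <= k < dy n.+1)
     normc (alpha k) ^+ 2 * (\sum_((p n).1 k <= j < k.+1) x j) ^+ 2)).
    by rewrite [leLHS]big_nat [leRHS]big_nat; apply: ler_sum => k kn; exact: res.
  have [_ pn _ good] := Hp n.
  have [tb|bt] := leP t (beta n).
    apply: le_trans (good tb x x0) _; rewrite ler_wpM2l ?sqr_ge0// lerDl.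
    by rewrite divr_ge0 ?sqr_ge0 ?exprn_ge0.
  apply: (@le_trans _ _ (mass n * (\sum_(0 <= j < dy n.+1) x j) ^+ 2)).
    rewrite /mass mulr_suml [leLHS]big_nat [leRHS]big_nat.
    apply: ler_sum => k /andP[_ kn].
    rewrite ler_wpM2l ?sqr_ge0// pn// ler_pXn2r ?nnegrE ?sumr_ge0//.
    by rewrite (@big_cat_nat _ _ _ k.+1 0 (dy n.+1))//= lerDl sumr_ge0.
  rewrite mulrDr ler_wpDl//.
    by rewrite mulr_ge0 ?sqr_ge0// sumr_ge0// => j _; rewrite sqr_ge0.
  have mt : mass n <= t ^+ 2 / 2 ^+ n.
    rewrite ler_pdivlMr ?exprn_gt0// mulrC -beta_sqr.
    by rewrite ler_pXn2r ?nnegrE ?beta_ge0 ?(ltW t0) ?(ltW bt).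
  have key (U : R) : 0 <= U -> mass n * U <= t ^+ 2 * (U / 2 ^+ n).
    by move=> U0; rewrite [U / _]mulrC mulrA; exact: ler_wpM2r.
  by apply: key; rewrite sqr_ge0.
rewrite -mulr_sumr big_split /=.
have hN : \sum_(0 <= j < dy N.+1) x j ^+ 2 <= 1.
  rewrite big_mkord; move: f1; rewrite -[1%E]/((1 : R)%:E) => /l2sq_leP; exact.
apply: (@le_trans _ _ (t ^+ 2 * (1 + H))).
  rewrite ler_wpM2l ?sqr_ge0// lerD//; first by rewrite -sum_blocks.
  by apply: le_trans (HH x N.+1 x0) _; rewrite ler_piMr.
rewrite exprMn mulrC ler_wpM2r ?sqr_ge0// expr2 ler_peMl ?addr_ge0//.
by rewrite lerDl.
Qed.

End RhalyUpper.

(** * From dyadic summability to the Schatten class *)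

Section DyadicSchatten.
Variable R : realType.
Implicit Types (q : R) (alpha : seqC R).

Lemma beta_powR q alpha n : beta alpha n `^ q = (2 ^+ n * mass alpha n) `^ (q / 2).
Proof.
rewrite -beta_sqr -powR_mulrn ?beta_ge0// -powRrM; congr (_ `^ _).
by rewrite mulrC divfK// pnatr_eq0.
Qed.

(** The n-th summand of (iii) lives on [I_(n+1)], where [beta] carries 2^(n+1) instead of 2^n: hence
    the factor 2^(-q/2), and the term [beta alpha 0] treated apart. *)
Lemma dyadic_condP q alpha :
  dyadic_cond q alpha <-> exists S, forall N, \sum_(n < N) beta alpha n `^ q <= S.
Proof.
have termE n : (2 ^+ n * \sum_(2 ^ n <= j < 2 ^ n.+1) normc (alpha j) ^+ 2) `^ (q / 2) =
    2^-1 `^ (q / 2) * beta alpha n.+1 `^ q.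
  rewrite beta_powR -powRM ?invr_ge0 ?mulr_ge0 ?exprn_ge0 ?mass_ge0//.
  by rewrite exprS -mulrA mulKf// pnatr_eq0.
have c0 : 0 < 2^-1 `^ (q / 2) :> R by rewrite powR_gt0// invr_gt0.
split=> [/nneseries_ltyP|[S HS]].
  case=> [n|S HS]; first exact: powR_ge0.
  exists (beta alpha 0 `^ q + S / 2^-1 `^ (q / 2)) => -[|N].
    rewrite big_ord0 addr_ge0 ?powR_ge0// divr_ge0 ?(ltW c0)//.
    by have := HS 0%N; rewrite big_ord0.
  rewrite big_ord_recl lerD2l ler_pdivlMr// mulr_suml.
  apply: le_trans (HS N); apply: ler_sum => n _.
  by rewrite termE mulrC.
apply/nneseries_ltyP => [n|]; first exact: powR_ge0.
exists (2^-1 `^ (q / 2) * S) => N.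
under eq_bigr do rewrite termE.
rewrite -mulr_sumr ler_wpM2l ?powR_ge0//.
apply: le_trans (HS N.+1); rewrite big_ord_recl /= ler_wpDl ?powR_ge0//.
Qed.

Lemma summable_tail_lt (y : nat -> R) q S (t : R) : 0 < q -> (forall n, 0 <= y n) ->
  (forall N, \sum_(n < N) y n `^ q <= S) -> 0 < t ->
  exists L, forall n, (L <= n)%N -> y n < t.
Proof.
move=> q0 y0 HS t0.
have cv : cvgn (series (fun n => y n `^ q)).
  apply: nondecreasing_is_cvgn.
    by apply: nondecreasing_series => n _ _; exact: powR_ge0.
  by exists S => _ [N _ <-]; rewrite /series /= big_mkord.
have /cvgrPdist_lt/(_ (t `^ q) ltac:(exact: powR_gt0)) [L _ HL] := cvg_series_cvg_0 cv.
exists L => n Ln; rewrite ltNge; apply/negP => tn.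
have := HL n Ln; rewrite sub0r normrN ger0_norm ?powR_ge0// ltNge.
by rewrite le_powR2r// ltW.
Qed.

(** At most X + 1 integers lie below [X], and [1 <= X] absorbs the 1; for small positive [X] the
    index 0 alone would break the bound. *)
Lemma sum_nat_below (X : R) K : 1 <= X -> \sum_(n < K | n%:R < X) (1 : R) <= 2 * X.
Proof.
move=> X1; apply: (@le_trans _ _ (\sum_(n < (Num.truncn X).+1) (1 : R))).
  rewrite -(big_mkord (fun n => n%:R < X) (fun=> 1)) -(big_mkord xpredT (fun=> 1)).
  set M := (_).+1.
  apply: (@le_trans _ _ (\sum_(0 <= i < maxn K M | i%:R < X) 1)).
    rewrite (@big_cat_nat _ _ _ K 0 (maxn K M)) ?leq_maxl//= lerDl sumr_ge0//.
  rewrite (@big_cat_nat _ _ _ M 0 (maxn K M)) ?leq_maxr//=.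
  rewrite [X in _ + X]big1_seq ?addr0.
    by rewrite big_mkcond; apply: ler_sum => n _; case: ifP.
  move=> n /andP[nX]; rewrite mem_index_iota => /andP[Mn _].
  have : M%:R < X by apply: le_lt_trans nX; rewrite ler_nat.
  by rewrite ltNge ltW// truncnS_gt.
rewrite sumr_const card_ord -[leLHS]natr1.
have h : (Num.truncn X)%:R <= X by rewrite truncn_le; lra.
lra.
Qed.

Lemma dyadic_Schatten q alpha : 1 < q -> in_l2 alpha ->
  dyadic_cond q alpha -> in_Schatten q (rhaly alpha).
Proof.
move=> q1 al2 /dyadic_condP[S HS]; have q0 : 0 < q by lra.
pose b := beta alpha; have b0 n : 0 <= b n by exact: beta_ge0.
have tail t : 0 < t -> exists L, forall n, (L <= n)%N -> b n < t.
  by move=> t0; apply: summable_tail_lt HS t0.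
have [D D0 HD] := rhaly_approx_num al2.
have fin0 : (approx_num (rhaly alpha) 0 < +oo)%E.
  have [L HL] := tail 1 ltr01.
  (* This exceeds every [b n], so no block is cut and rank 0 suffices: the operator is bounded. *)
  pose t := 1 + \sum_(n < L) b n.
  have t0 : 0 < t by rewrite ltr_pwDl// sumr_ge0.
  have bt n : b n < t.
    have [nL|Ln] := ltnP n L.
      rewrite /t (bigD1 (Ordinal nL))//= addrCA ltrDl ltr_pwDl// sumr_ge0//.
    by apply: lt_le_trans (HL _ Ln) _; rewrite lerDl sumr_ge0.
  apply: (@le_lt_trans _ _ (D * t)%:E); last exact: ltry.
  apply: (HD t 0%N) => [//|n _|]; first exact: bt.
  by rewrite big_ord0 mulr0.
have fin n : (approx_num (rhaly alpha) n < +oo)%E.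
  by apply: le_lt_trans fin0; exact: approx_num_noninc.
split; first by apply: le_lt_trans fin0; exact: opnorm_le_approx_num0.
split=> //; apply/nneseries_ltyP => [n|]; first exact: powR_ge0.
(* At the level t' = t / (2D) the bound D t' is t / 2, below [t]. The number of indices is then at
   most 2X with X = 5B / t', and t * 2X = 20 D B. *)
have c0 : 0 < (2 * D)^-1 by rewrite invr_gt0 mulr_gt0.
have E0 : 0 <= 20 * D by rewrite mulr_ge0// ltW.
have [G G0 HG] := sum_powR_of_tails q1 c0 E0.
exists (G * S); apply: (HG (fun n => fine (approx_num (rhaly alpha) n)) b (fun=> 1)) => //.
- by move=> n; rewrite fine_ge0// approx_num_ge0.
- move=> K t t0; pose t' := (2 * D)^-1 * t.
  have t'0 : 0 < t' by rewrite mulr_gt0.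
  have [L HL] := tail t' t'0; exists L.
  under [in leRHS]eq_bigr do rewrite mul1r.
  rewrite -/t'; set B := \sum_(i < L | t' <= b i) b i.
  pose X := 5 * (B / t').
  have small n : X <= n%:R -> fine (approx_num (rhaly alpha) n) < t.
    move=> Xn; have := HD t' L n t'0 HL.
    rewrite -mulr_suml => /(_ Xn) h.
    have : fine (approx_num (rhaly alpha) n) <= D * t'.
      rewrite -lee_fin fineK// ge0_fin_numE ?fin// approx_num_ge0//.
    have -> : D * t' = t / 2 by rewrite /t'; field; rewrite gt_eqF.
    by move=> /le_lt_trans; apply; lra.
  have cnt : \sum_(n < K | t <= fine (approx_num (rhaly alpha) n)) 1 <=
      \sum_(n < K | n%:R < X) (1 : R).
    rewrite big_mkcond [leRHS]big_mkcond; apply: ler_sum => n _ /=.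
    case: ifP => [tn|_]; last by case: ifP.
    by case: ltP => // /small; rewrite ltNge tn.
  have [X1|X1] := leP 1 X.
    apply: (@le_trans _ _ (t * (2 * X))).
      by rewrite ler_pM2l// (le_trans cnt)// sum_nat_below.
    rewrite /X /t' le_eqVlt; apply/orP; left; apply/eqP.
    by field; rewrite !gt_eqF.
  have B0 : 0 <= B by apply: sumr_ge0.
  (* A single [b i >= t'] would force [B >= t'] and X >= 5, so for X < 1 the tail is empty. *)
  suff B00 : B = 0.
    rewrite B00 mulr0; apply: mulr_ge0_le0; [exact: ltW|apply: le_trans cnt _].
    rewrite /X B00 mul0r mulr0 big1// => n; by rewrite ltNge ler0n.
  apply: contrapT => /eqP; rewrite /B => /eqP Bn.
  have [i ti] : exists i : 'I_L, t' <= b i.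
    apply: contrapT => no; apply: Bn; rewrite big1// => i ti.
    by case: no; exists i.
  have : t' <= B.
    by rewrite /B (bigD1 i)//=; apply: le_trans ti _; rewrite lerDl sumr_ge0.
  move=> tB; have : 1 <= B / t' by rewrite ler_pdivlMr// mul1r.
  by move: X1; rewrite /X; lra.
- by move=> N; under eq_bigr do rewrite mul1r; exact: HS.
Qed.

End DyadicSchatten.

(** * Traces and the lower bound for approximation numbers *)

Section TraceRank.
Variable F : numClosedFieldType.
Local Notation "M ^t*" := (map_mx (@Num.conj F) (M ^T)) (at level 30).

(* A bound on the numerical radius; it is subadditive, which is all that is needed of a norm. *)
Definition numrad_le N (A : 'M[F]_N) (e : F) :=
  forall u : 'rV[F]_N, u *m u^t* = 1%:M -> `|(u *m A *m u^t*) 0 0| <= e.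

Lemma unitary_proj_id m n r (A : 'M[F]_(m, n)) (U : 'M[F]_(r, n)) :
  U *m U^t* = 1%:M -> (A <= U)%MS -> A = A *m U^t* *m U.
Proof.
by move=> Uu /submxP[B ->]; rewrite -(mulmxA B U) Uu mulmx1.
Qed.

(* The trace of [A] is that of its compression to its row space, computed in an
   orthonormal basis. *)
Lemma trace_le_rank N (A : 'M[F]_N) (e : F) :
  numrad_le A e -> `|\tr A| <= e *+ \rank A.
Proof.
move=> Ae; pose U := schmidt (row_base A).
have Uu : U *m U^t* = 1%:M.
  by apply/unitarymxP/schmidt_unitarymx/rank_leq_col.
have AU : A = A *m U^t* *m U.
  apply: unitary_proj_id => //.
  by rewrite (submx_trans _ (schmidt_sub _))// eq_row_base.
rewrite {1}AU mxtrace_mulC mulmxA.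
apply: le_trans (ler_norm_sum _ _ _) _.
rewrite -[X in _ *+ X]card_ord -sumr_const; apply: ler_sum => i _.
have := Ae (row i U).
have -> : row i U *m (row i U)^t* = 1%:M.
  apply/matrixP => a b; rewrite !ord1; have /matrixP/(_ i i) := Uu.
  rewrite !mxE eqxx => <-; apply: eq_bigr => j _; by rewrite !mxE.
move=> /(_ erefl); congr (_ <= _); congr (`|_|).
by rewrite -row_mul !mxE; apply: eq_bigr => j _; rewrite !mxE.
Qed.

Lemma numrad_leB N (A B : 'M[F]_N) (a b : F) :
  numrad_le A a -> numrad_le B b -> numrad_le (A - B) (a + b).
Proof.
move=> Aa Bb u uu; rewrite mulmxBr mulmxBl mxE [X in _ + X]mxE.
by apply: (le_trans (ler_normB _ _)); rewrite lerD ?Aa ?Bb.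
Qed.

(** [P 0] has rank below 1 and vanishes, so [M] is [M - P L] plus the increments [P i.+1 - P i]. An
    increment is a difference of two errors, hence of small numerical radius, and its rank is of
    order 2^i; only the last error is charged the full size [N]. *)
Lemma trace_telescope N (M : 'M[F]_N) (P : nat -> 'M[F]_N) (e : nat -> F) L :
  (forall i, (\rank (P i) < 2 ^ i)%N) -> (forall i, numrad_le (M - P i) (e i)) ->
  (forall i, 0 <= e i) ->
  `|\tr M| <= e L *+ N + \sum_(i < L) (e i + e i.+1) *+ (2 ^ i + 2 ^ i.+1).
Proof.
move=> rP Me e0.
have dec : M = (M - P L) + \sum_(i < L) ((M - P i) - (M - P i.+1)).
  elim: L => [|L IH].
    have := rP 0%N; rewrite expn0 ltnS leqn0 mxrank_eq0 => /eqP ->.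
    by rewrite big_ord0 subr0 addr0.
  by rewrite big_ord_recr /= [X in _ + X]addrC addrA [in X in _ = X + _]addrC subrK.
rewrite {1}dec raddfD /= raddf_sum /=.
apply: (le_trans (ler_normD _ _)); apply: lerD.
  apply: (le_trans (trace_le_rank (Me L))).
  by rewrite ler_wpMn2l// rank_leq_row.
apply: le_trans (ler_norm_sum _ _ _) _; apply: ler_sum => i _.
apply: (le_trans (trace_le_rank (numrad_leB (Me i) (Me i.+1)))).
rewrite ler_wpMn2l ?addr_ge0//.
rewrite (_ : M - P i - (M - P i.+1) = P i.+1 - P i); last first.
  by rewrite opprB addrC addrA subrK.
apply: (leq_trans (mxrank_add _ _)); rewrite addnC leq_add// ?mxrank_opp ltnW ?rP//.
Qed.

End TraceRank.

(** * Compression of operators to finite matrices *)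

Section Compression.
Variable R : realType.
Local Notation C := R[i].
Implicit Types (f g : seqC R) (X P : seqC R -> seqC R).

(** Linearity without stability of l^2, which [rhaly] lacks for a general [alpha]. *)
Definition linear_eq X := forall (a : C) f g, in_l2 f -> in_l2 g ->
  X (fun k => a * f k + g k) = (fun k => a * X f k + X g k).

Lemma linear_eqB X P : linear_eq X -> linear_eq P -> linear_eq (fun f k => X f k - P f k).
Proof.
move=> lX lP a f g fl gl; rewrite lX// lP//; apply: funext => k; ring.
Qed.

Lemma rhaly_linear_eq alpha : linear_eq (@rhaly R alpha).
Proof.
move=> a f g _ _; apply: funext => k; rewrite /rhaly big_split /= -mulr_sumr; ring.
Qed.

Lemma linear_eq_sum X n (c : 'I_n -> C) (v : 'I_n -> seqC R) : linear_eq X ->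
  (forall i, in_l2 (v i)) ->
  X (fun k => \sum_(i < n) c i * v i k) = (fun k => \sum_(i < n) c i * X (v i) k).
Proof.
move=> lX; elim: n c v => [|n IH] c v vl2.
  have X0 : X (fun=> 0) = fun=> 0.
    have := lX 0 _ _ (in_l20 R) (in_l20 R).
    rewrite (_ : (fun k => 0 * 0 + 0) = fun=> 0); last by apply: funext => k; rewrite mul0r addr0.
    have := lX (-1) _ _ (in_l20 R) (in_l20 R).
    rewrite (_ : (fun k => -1 * 0 + 0) = fun=> 0); last by apply: funext => k; rewrite mulr0 addr0.
    by move=> -> _; apply: funext => k; rewrite mulN1r addNr.
  rewrite (_ : (fun k => _) = fun=> 0); last by apply: funext => k; rewrite big_ord0.
  by rewrite X0; apply: funext => k; rewrite big_ord0.
rewrite (_ : (fun k => _) = (fun k => c ord0 * v ord0 k + \sum_(i < n) c (lift ord0 i) * v (lift ord0 i) k)); last first.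
  by apply: funext => k; rewrite big_ord_recl.
rewrite lX//; last exact: in_l2_sum.
by rewrite IH//; apply: funext => k; rewrite big_ord_recl.
Qed.

Lemma conjC_normc (z : C) : normc (z^*) = normc z.
Proof. by apply: complexI; rewrite -!normcE_C norm_conjC. Qed.

Lemma normc_CauchySchwarz (I : Type) (l : seq I) (F G : I -> C) (a b : R) : 0 <= a -> 0 <= b ->
  \sum_(i <- l) normc (F i) ^+ 2 <= a ^+ 2 -> \sum_(i <- l) normc (G i) ^+ 2 <= b ^+ 2 ->
  normc (\sum_(i <- l) F i * G i) <= a * b.
Proof.
move=> a0 b0 Fa Gb; apply: (le_trans (normc_sum_le _ _ _)).
under eq_bigr do rewrite Normc.normcM.
rewrite -(ler_pXn2r (ltn0Sn 1)) ?nnegrE ?mulr_ge0 ?sumr_ge0//; last first.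
  by move=> i _; rewrite mulr_ge0 ?normc_ge0.
apply: (le_trans (sum_CauchySchwarz _ _ _ _)).
by rewrite exprMn ler_pM ?sumr_ge0// => i _; rewrite sqr_ge0.
Qed.

Variables (N : nat) (e g : 'I_N -> seqC R) (K : nat).
Hypothesis e_disj : forall i j k, e i k != 0 -> e j k != 0 -> i = j.
Hypothesis g_disj : forall i j k, g i k != 0 -> g j k != 0 -> i = j.
Hypothesis e_unit : forall i M, \sum_(k < M) normc (e i k) ^+ 2 <= 1.
Hypothesis g_unit : forall i M, \sum_(k < M) normc (g i k) ^+ 2 <= 1.

(** At each coordinate at most one summand survives, so the squared modulus passes through the
    sum. *)
Lemma disjoint_comb_le (v : 'I_N -> seqC R) (c : 'I_N -> C) :
  (forall i j k, v i k != 0 -> v j k != 0 -> i = j) ->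
  (forall i M, \sum_(k < M) normc (v i k) ^+ 2 <= 1) ->
  \sum_i normc (c i) ^+ 2 <= 1 ->
  forall M, \sum_(k < M) normc (\sum_i c i * v i k) ^+ 2 <= 1.
Proof.
move=> disj unit c1 M.
have pt k : normc (\sum_i c i * v i k) ^+ 2 <= \sum_i normc (c i) ^+ 2 * normc (v i k) ^+ 2.
  have [[i vi]|no] := pselect (exists i, v i k != 0).
    rewrite (bigD1 i)//= big1 ?addr0; last first.
      move=> j ji; apply/eqP; rewrite mulf_eq0; apply/orP; right.
      by apply: contraNT ji => vj; apply/eqP; exact: disj vj vi.
    rewrite Normc.normcM exprMn (bigD1 i)//= lerDl sumr_ge0// => j _.
    by rewrite mulr_ge0 ?sqr_ge0.
  rewrite big1; last first.
    move=> i _; apply/eqP; rewrite mulf_eq0; apply/orP; right; apply/negPn/negP => vi.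
    by apply: no; exists i.
  rewrite Normc.normc0 expr0n sumr_ge0// => j _.
  by rewrite mulr_ge0 ?sqr_ge0.
apply: (@le_trans _ _ (\sum_(k < M) \sum_i normc (c i) ^+ 2 * normc (v i k) ^+ 2)).
  by apply: ler_sum => k _; exact: pt.
rewrite exchange_big /=; apply: le_trans c1; apply: ler_sum => i _.
rewrite -mulr_sumr; apply: ler_piMr; rewrite ?sqr_ge0//; exact: unit.
Qed.

(** Pairings of [X (e j)] with [g i], stopped at [K] coordinates so that the entries are finite sums
    whatever [X] is. *)
Definition compression X : 'M[C]_N :=
  \matrix_(i, j) \sum_(k < K) (g i k)^* * X (e j) k.

Lemma compressionB X P :
  compression (fun f k => X f k - P f k) = compression X - compression P.
Proof.
apply/matrixP => i j; rewrite !mxE -sumrB; apply: eq_bigr => k _.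
by rewrite mulrBr.
Qed.

Lemma e_l2 i : in_l2 (e i).
Proof. by apply/in_l2P; exists 1. Qed.

(** The matrix factors through the [n] coefficients of [P (e j)] in the spanning family. *)
Lemma compression_rank P n : rank_le P n -> (\rank (compression P) <= n)%N.
Proof.
move=> [v [_ Pv]].
have [c Hc] := choice (fun j => Pv (e j) (e_l2 j)).
have -> : compression P = (\matrix_(i < N, l < n) \sum_(k < K) (g i k)^* * v l k) *m
    (\matrix_(l < n, j < N) c j l).
  apply/matrixP => i j; rewrite !mxE Hc.
  under eq_bigr do rewrite mulr_sumr.
  rewrite exchange_big /=; apply: eq_bigr => l _; rewrite !mxE mulr_suml.
  by apply: eq_bigr => k _; ring.
exact: (leq_trans (mxrankM_maxl _ _) (rank_leq_col _)).
Qed.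

(** The form at a unit row [u] is the pairing of [X E] with [G], where [E] and [G] combine the [e i]
    and the [g i] with the conjugate coefficients of [u]; disjoint supports keep both in the unit
    ball. *)
Lemma compression_numrad X (d : R) : linear_eq X -> 0 <= d ->
  (opnorm X <= d%:E)%E -> numrad_le (compression X) (d%:C)%C.
Proof.
move=> lX d0 Xd u uu.
have u1 : \sum_i normc (u 0 i) ^+ 2 = 1.
  apply: complexI; rewrite rmorph_sum /=.
  have <- : \sum_i u 0 i * (u 0 i)^* = (1%:C)%C.
    have /matrixP/(_ 0 0) := uu; rewrite !mxE eqxx mulr1n rmorph1 => <-.
    by apply: eq_bigr => i _; rewrite !mxE.
  by apply: eq_bigr => i _; rewrite rmorphXn /= -normcE_C normCK.
have uc1 : \sum_i normc ((u 0 i)^*) ^+ 2 <= 1.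
  by under eq_bigr do rewrite conjC_normc; rewrite u1.
pose E := fun k => \sum_i (u 0 i)^* * e i k.
pose G := fun k => \sum_i (u 0 i)^* * g i k.
have -> : (u *m compression X *m map_mx (@Num.conj _) (u^T)) 0 0 = \sum_(k < K) (G k)^* * X E k.
  have GK k : (G k)^* = \sum_i u 0 i * (g i k)^*.
    by rewrite /G rmorph_sum; apply: eq_bigr => i _; rewrite rmorphM /= conjCK.
  rewrite (linear_eq_sum _ lX e_l2) !mxE.
  transitivity (\sum_j \sum_i \sum_(k < K) u 0 i * (g i k)^* * ((u 0 j)^* * X (e j) k)).
    apply: eq_bigr => j _; rewrite !mxE mulr_suml; apply: eq_bigr => i _.
    rewrite !mxE mulr_sumr mulr_suml; apply: eq_bigr => k _; ring.
  under [RHS]eq_bigr do rewrite GK big_distrlr /=.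
  rewrite [RHS]exchange_big /= exchange_big /=; apply: eq_bigr => i _.
  by rewrite [RHS]exchange_big.
rewrite normcE_C lecR -[d]mul1r.
apply: normc_CauchySchwarz => //.
  rewrite expr1n; under eq_bigr do rewrite conjC_normc.
  exact: disjoint_comb_le.
have /opnorm_leP H := Xd; apply: H => //.
by apply/l2sq_leP; exact: disjoint_comb_le.
Qed.

End Compression.

(** * Test vectors and the counting estimate *)

Section RhalyLower.
Variable R : realType.
Local Notation C := R[i].
Variable alpha : seqC R.

Definition block_len n : R := (dy n.+1 - dy n)%:R.

Lemma block_len_ge n : 2 ^+ n <= 2 * block_len n.
Proof.
rewrite /block_len; case: n => [|n]; first by rewrite expr0 /= subn0; lra.
by rewrite !dyS expnS mul2n -addnn addnK natrX exprS.
Qed.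

Lemma block_len_gt0 n : 0 < block_len n.
Proof.
have := block_len_ge n; have : 0 < 2 ^+ n :> R by rewrite exprn_gt0.
lra.
Qed.

Definition test_in n : seqC R := fun k =>
  if (dy n <= k < dy n.+1)%N then ((Num.sqrt (block_len n))^-1)%:C%C else 0.

Definition test_out n : seqC R := fun k =>
  if (dy n.+1 <= k < dy n.+2)%N then ((Num.sqrt (mass alpha n.+1))^-1)%:C%C * alpha k else 0.

Lemma sum_block_restrict n (F : nat -> R) M :
  (forall k, 0 <= F k) ->
  \sum_(k < M) (if (dy n <= k < dy n.+1)%N then F k else 0) <=
  \sum_(dy n <= k < dy n.+1) F k.
Proof.
move=> F0; pose G k := if (dy n <= k < dy n.+1)%N then F k else 0.
have G0 k : 0 <= G k by rewrite /G; case: ifP.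
rewrite -(big_mkord xpredT G).
apply: (@le_trans _ _ (\sum_(0 <= k < maxn M (dy n.+1)) G k)).
  by rewrite (@big_cat_nat _ _ _ M 0 (maxn M (dy n.+1))) ?leq_maxl//= lerDl sumr_ge0.
rewrite (@big_cat_nat _ _ _ (dy n) 0 (maxn M (dy n.+1)))//=; last first.
  by rewrite (leq_trans (dy_mono (leqnSn n))) ?leq_maxr.
rewrite big1_seq ?add0r; last first.
  move=> k /andP[_]; rewrite mem_index_iota => /andP[_ kn].
  by rewrite /G leqNgt kn.
rewrite (@big_cat_nat _ _ _ (dy n.+1) (dy n) (maxn M (dy n.+1))) ?dy_mono ?leq_maxr//=.
rewrite [X in _ + X]big1_seq ?addr0; last first.
  move=> k /andP[_]; rewrite mem_index_iota => /andP[kn _].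
  by rewrite /G ltnNge kn andbF.
by rewrite [leLHS]big_nat [leRHS]big_nat; apply: ler_sum => k kn; rewrite /G kn.
Qed.

Lemma test_in_unit n M : \sum_(k < M) normc (test_in n k) ^+ 2 <= 1.
Proof.
have l0 := block_len_gt0 n.
rewrite (eq_bigr (fun k : 'I_M => if (dy n <= k < dy n.+1)%N then (block_len n)^-1 else 0)); last first.
  move=> k _; rewrite /test_in; case: ifP => _; last by rewrite Normc.normc0 expr0n.
  by rewrite normc_real real_normK ?num_real// exprVn sqr_sqrtr// ltW.
apply: (le_trans (@sum_block_restrict n (fun=> (block_len n)^-1) M _)).
  by move=> k; rewrite invr_ge0 ltW.
rewrite sumr_const_nat -mulr_natl -/(block_len n) divff// gt_eqF//.
Qed.

Lemma test_out_unit n M : 0 < mass alpha n.+1 ->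
  \sum_(k < M) normc (test_out n k) ^+ 2 <= 1.
Proof.
move=> m0.
rewrite (eq_bigr (fun k : 'I_M => if (dy n.+1 <= k < dy n.+2)%N
    then (mass alpha n.+1)^-1 * normc (alpha k) ^+ 2 else 0)); last first.
  move=> k _; rewrite /test_out; case: ifP => _; last by rewrite Normc.normc0 expr0n.
  by rewrite Normc.normcM normc_real exprMn real_normK ?num_real// exprVn sqr_sqrtr// ltW.
apply: (le_trans (@sum_block_restrict n.+1 (fun k => (mass alpha n.+1)^-1 * normc (alpha k) ^+ 2) M _)).
  by move=> k; rewrite mulr_ge0 ?sqr_ge0// invr_ge0 ltW.
by rewrite -mulr_sumr -/(mass alpha n.+1) mulVf// gt_eqF.
Qed.

(** The support of [test_in n] lies entirely to the left of this block, so the partial sum has the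
    full value |I_n| / sqrt |I_n|. *)
Lemma rhaly_test_in n k : (dy n.+1 <= k < dy n.+2)%N ->
  rhaly alpha (test_in n) k = alpha k * (Num.sqrt (block_len n))%:C%C.
Proof.
move=> /andP[nk _]; rewrite /rhaly; congr (_ * _).
rewrite (@big_cat_nat _ _ _ (dy n) 0 k.+1)//=; last first.
  by rewrite ltnW// ltnS (leq_trans (dy_mono (leqnSn n))).
rewrite big1_seq ?add0r; last first.
  move=> j /andP[_]; rewrite mem_index_iota => /andP[_ jn].
  by rewrite /test_in leqNgt jn.
rewrite (@big_cat_nat _ _ _ (dy n.+1) (dy n) k.+1) ?dy_mono ?leqW//=.
rewrite [X in _ + X]big1_seq ?addr0; last first.
  move=> j /andP[_]; rewrite mem_index_iota => /andP[jn _].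
  by rewrite /test_in ltnNge jn andbF.
rewrite big_nat (eq_bigr (fun=> ((Num.sqrt (block_len n))^-1)%:C%C)); last first.
  by move=> j jn; rewrite /test_in jn.
rewrite -big_nat sumr_const_nat -[RHS]/(real_complex R _) -[X in X *+ _]/(real_complex R _).
rewrite -rmorphMn; congr (real_complex R _); rewrite -mulr_natl -/(block_len n) -{1}[block_len n]sqr_sqrtr ?(ltW (block_len_gt0 n))//.
by rewrite expr2 mulfK// gt_eqF// sqrtr_gt0 block_len_gt0.
Qed.

Lemma diag_entry n K : (dy n.+2 <= K)%N -> 0 < mass alpha n.+1 ->
  \sum_(k < K) (test_out n k)^* * rhaly alpha (test_in n) k =
  (Num.sqrt (mass alpha n.+1 * block_len n))%:C%C.
Proof.
move=> nK m0.
rewrite -(big_mkord xpredT (fun k => (test_out n k)^* * rhaly alpha (test_in n) k)).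
have nK' : (dy n.+1 <= K)%N by rewrite (leq_trans _ nK)// dy_mono.
rewrite (@big_cat_nat _ _ _ (dy n.+1) 0 K)//=.
rewrite big1_seq ?add0r; last first.
  move=> j /andP[_]; rewrite mem_index_iota => /andP[_ jn].
  by rewrite /test_out leqNgt jn conjC0 mul0r.
rewrite (@big_cat_nat _ _ _ (dy n.+2) (dy n.+1) K) ?dy_mono//=.
rewrite [X in _ + X]big1_seq ?addr0; last first.
  move=> j /andP[_]; rewrite mem_index_iota => /andP[jn _].
  by rewrite /test_out [(j < _)%N]ltnNge jn andbF conjC0 mul0r.
rewrite big_nat (eq_bigr (fun k => ((Num.sqrt (mass alpha n.+1))^-1 * Num.sqrt (block_len n) * normc (alpha k) ^+ 2)%:C%C)); last first.
  move=> k kn; rewrite rhaly_test_in// /test_out kn rmorphM /=.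
  rewrite (_ : ((_%:C)%C)^* = ((Num.sqrt (mass alpha n.+1))^-1)%:C%C); last first.
    by apply/CrealP; rewrite complex_real.
  rewrite 2!rmorphM /= rmorphXn /= -normcE_C normCK; ring.
rewrite -big_nat -rmorph_sum /= -mulr_sumr -/(mass alpha n.+1).
congr (_%:C)%C; rewrite sqrtrM ?mass_ge0// -{2}[mass alpha n.+1]sqr_sqrtr ?mass_ge0//.
by field; rewrite gt_eqF// sqrtr_gt0.
Qed.

Lemma opnorm_fin_approx (T : seqC R -> seqC R) n (d : R) :
  (approx_num T n < +oo)%E -> 0 < d ->
  exists P, [/\ linear_on_l2 P, rank_le P n &
    (opnorm (fun f k => T f k - P f k)%R <= (fine (approx_num T n) + d)%:E)%E].
Proof.
move=> fin d0.
have finn : approx_num T n \is a fin_num by rewrite ge0_fin_numE// approx_num_ge0.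
have [_ [P [lP rP] <-] h] := lb_ereal_inf_adherent d0 finn.
by exists P; split => //; rewrite EFinD fineK// ltW.
Qed.

(** For the [N] indices counted on the left the compressed matrix has trace at least t N, while
    telescoping bounds it through the [b i]. The [b i] below t / 48 and the slack cost at most half
    of t N and are absorbed. *)
Lemma rhaly_count (K : nat) (t : R) : 0 < t ->
  (forall n, (approx_num (rhaly alpha) n < +oo)%E) ->
  let b i := fine (approx_num (rhaly alpha) (2 ^ i).-1) in
  exists L, t * \sum_(n < K | t <= beta alpha n.+1 / 2) 1 <=
    24 * \sum_(i < L | 48^-1 * t <= b i) 2 ^+ i * b i.
Proof.
move=> t0 fin b.
have b0 i : 0 <= b i by rewrite fine_ge0// approx_num_ge0.
pose A := [pred n : 'I_K | t <= beta alpha n.+1 / 2].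
pose N := #|A|; pose idx (i : 'I_N) : nat := @enum_val _ A i.
have idxt i : t <= beta alpha (idx i).+1 / 2.
  by have := @enum_valP _ A i.
have idx_inj : injective idx by move=> i j /val_inj/enum_val_inj.
have idxK i : (idx i < K)%N by exact: ltn_ord.
rewrite sumr_const -/N.
have [->|Npos] := posnP N.
  by exists 0%N; rewrite big_ord0 !mulr0.
have mpos i : 0 < mass alpha (idx i).+1.
  have : 0 < beta alpha (idx i).+1 ^+ 2 by rewrite exprn_gt0//; have := idxt i; lra.
  by rewrite beta_sqr pmulr_rgt0// exprn_gt0.
pose e i := test_in (idx i); pose g i := test_out (idx i).
pose M := compression e g (dy K.+1) (rhaly alpha).
have e_disj i j k : e i k != 0 -> e j k != 0 -> i = j.
  rewrite /e /test_in; case: ifP => [ki _|_]; last by rewrite eqxx.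
  case: ifP => [kj _|_]; last by rewrite eqxx.
  exact/idx_inj/(dy_block_inj ki kj).
have g_disj i j k : g i k != 0 -> g j k != 0 -> i = j.
  rewrite /g /test_out; case: ifP => [ki _|_]; last by rewrite eqxx.
  case: ifP => [kj _|_]; last by rewrite eqxx.
  by apply: idx_inj; have [] := dy_block_inj ki kj.
have e_unit i m : \sum_(k < m) normc (e i k) ^+ 2 <= 1 by exact: test_in_unit.
have g_unit i m : \sum_(k < m) normc (g i k) ^+ 2 <= 1 by exact: test_out_unit.
(* Both the slack of the near-minimisers and the threshold under which [b i] is dropped. [step1] and
   [step2] give t N <= 24 d N + 12 S, whose first term is t N / 2. *)
pose d := 48^-1 * t; have d0 : 0 < d by rewrite mulr_gt0.
have [P HP] := choice (fun i => opnorm_fin_approx (fin (2 ^ i).-1) d0).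
pose Q i := compression e g (dy K.+1) (P i).
have rQ i : (\rank (Q i) < 2 ^ i)%N.
  have [_ rP _] := HP i.
  have := compression_rank g (dy K.+1) e_unit rP.
  by rewrite -ltnS prednK ?expn_gt0.
have MQ i : numrad_le (M - Q i) ((b i + d)%:C)%C.
  have [lP _ oP] := HP i.
  rewrite -compressionB; apply: compression_numrad => //.
  - by apply: linear_eqB; [exact: rhaly_linear_eq|case: lP].
  - by rewrite addr_ge0// ltW.
have ed0 i : 0 <= ((b i + d)%:C)%C :> C by rewrite ler0c addr_ge0// ltW.
(* The approximants stop at rank about [N]: the last error, charged [N] times, then weighs at most
   [2 * 2 ^ L]. *)
pose L := trunc_log 2 N.
have LN : (2 ^ L <= N)%N by exact: trunc_logP.
have NL : (N < 2 ^ L.+1)%N by exact: trunc_log_ltn.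
have trM : \tr M = (\sum_i Num.sqrt (mass alpha (idx i).+1 * block_len (idx i)))%:C%C.
  rewrite rmorph_sum /=; apply: eq_bigr => i _; rewrite mxE diag_entry//.
  by apply: dy_mono; exact: idxK.
have trle : `|\sum_i Num.sqrt (mass alpha (idx i).+1 * block_len (idx i))| <=
    (b L + d) *+ N + \sum_(i < L) (b i + d + (b i.+1 + d)) *+ (2 ^ i + 2 ^ i.+1).
  rewrite -lecR -normc_real -normcE_C -trM rmorphD rmorphMn rmorph_sum /=.
  apply: (le_trans (trace_telescope L rQ MQ ed0)); rewrite lerD2l.
  apply: ler_sum => i _.
  by rewrite [leRHS](rmorphMn (real_complex R)) [X in _ <= X *+ _](rmorphD (real_complex R)).
(* Since |I_n| >= 2^n / 2 = 2^(n+1) / 4, the diagonal entry is at least half of beta_(n+1). *)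
have trge : t *+ N <= \sum_i Num.sqrt (mass alpha (idx i).+1 * block_len (idx i)).
  rewrite -[X in _ *+ X]card_ord -sumr_const; apply: ler_sum => i _.
  apply: le_trans (idxt i) _.
  rewrite -(ler_pXn2r (ltn0Sn 1)) ?nnegrE ?divr_ge0 ?beta_ge0 ?sqrtr_ge0//.
  rewrite sqr_sqrtr ?mulr_ge0 ?mass_ge0 ?(ltW (block_len_gt0 _))//.
  rewrite exprMn beta_sqr exprS.
  have := block_len_ge (idx i); have := mpos i; move: (mass _ _) (block_len _) => m l.
  set p := 2 ^+ _ => m0 pl; nra.
have {trge trle} key := le_trans trge (le_trans (ler_norm _) trle).
exists L.+1; rewrite -/d; set S := \sum_(i < L.+1 | d <= b i) 2 ^+ i * b i.
have bmono i : b i.+1 <= b i.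
  rewrite fine_le ?ge0_fin_numE ?approx_num_ge0//.
  by apply: approx_num_noninc; rewrite -ltnS !prednK ?expn_gt0// leq_exp2l.
(* By monotonicity of [b] an increment costs at most 2 (b_i + d) times the rank 3 * 2^i, whence the
   6. *)
have step1 : t *+ N <= 6 * \sum_(i < L.+1) 2 ^+ i * (b i + d).
  apply: (le_trans key); rewrite big_ord_recr /= mulrDr addrC lerD//.
    rewrite mulr_sumr; apply: ler_sum => i _.
    rewrite -[leLHS]mulr_natl natrD !natrX exprS.
    have := bmono i; have : 0 < 2 ^+ i :> R by rewrite exprn_gt0.
    move: (2 ^+ i) (b i) (b i.+1) => p x y p0 yx; nra.
  rewrite -[leLHS]mulr_natl mulrA ler_wpM2r ?addr_ge0// ?(ltW d0)//.
  have : N%:R <= 2 ^+ L.+1 :> R by rewrite -natrX ler_nat ltnW.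
  rewrite exprS; have : 0 < 2 ^+ L :> R by rewrite exprn_gt0.
  by lra.
have step2 : \sum_(i < L.+1) 2 ^+ i * (b i + d) <= 4 * d * N%:R + 2 * S.
  apply: (@le_trans _ _ (\sum_(i < L.+1) (2 * d * 2 ^+ i + 2 * (if d <= b i then 2 ^+ i * b i else 0)))).
    apply: ler_sum => i _; have : 0 < 2 ^+ i :> R by rewrite exprn_gt0.
    move=> p0; have pd := mulr_ge0 (ltW p0) (ltW d0).
    have [_|bd] := leP d (b i).
      by have pb := mulr_ge0 (ltW p0) (b0 i); lra.
    have pbd : 0 <= 2 ^+ i * (d - b i) by rewrite mulr_ge0 ?subr_ge0 ?(ltW bd) ?(ltW p0).
    by lra.
  rewrite big_split /= -!mulr_sumr /S [X in _ <= _ + _ * X]big_mkcond lerD2r.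
  have -> : \sum_(i < L.+1) 2 ^+ i = 2 * 2 ^+ L - 1 :> R.
    by rewrite -exprS subrX1 (_ : 2 - 1 = 1) ?mul1r//; lra.
  have LN' : 2 ^+ L <= N%:R :> R by rewrite -natrX ler_nat.
  have := ler_wpM2l (ltW d0) LN'; lra.
have dt : t = 48 * d by rewrite /d mulrA divff ?mul1r.
move: step1 step2; rewrite -[t *+ N]mulr_natr dt; lra.
Qed.

(** Cauchy condensation: every index of [I_i] is at most 2^i - 1, and [I_i] has at least 2^i / 2
    elements. The predecessor appears because [approx_num T n] is a_(n+1). *)
Lemma sum_condensed q (T : seqC R -> seqC R) S : 0 < q ->
  (forall n, (approx_num T n < +oo)%E) ->
  (forall N, \sum_(n < N) fine (approx_num T n) `^ q <= S) ->
  forall N, \sum_(i < N) 2 ^+ i * fine (approx_num T (2 ^ i).-1) `^ q <= 2 * S.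
Proof.
move=> q0 fin HS N.
apply: (@le_trans _ _ (2 * \sum_(0 <= k < dy N) fine (approx_num T k) `^ q)); last first.
  by rewrite ler_pM2l// big_mkord.
rewrite sum_blocks mulr_sumr; apply: ler_sum => i _.
apply: (@le_trans _ _ (2 * (block_len i * fine (approx_num T (2 ^ i).-1) `^ q))).
  by rewrite mulrA ler_wpM2r ?powR_ge0// block_len_ge.
rewrite ler_pM2l// mulr_natl -sumr_const_nat [leLHS]big_nat [leRHS]big_nat.
apply: ler_sum => k /andP[_ ki]; apply: le_powR2r.
- exact: ltW.
- by rewrite fine_ge0// approx_num_ge0.
rewrite fine_le ?ge0_fin_numE ?approx_num_ge0//; apply: approx_num_noninc.
by rewrite -ltnS prednK ?expn_gt0.
Qed.

End RhalyLower.

Lemma Schatten_dyadic (R : realType) (q : R) (alpha : seqC R) : 1 < q ->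
  in_Schatten q (rhaly alpha) -> dyadic_cond q alpha.
Proof.
move=> q1 [_ [fin /nneseries_ltyP]]; case=> [n|S HS]; first exact: powR_ge0.
have q0 : 0 < q by lra.
have c0 : 0 < 48^-1 :> R by rewrite invr_gt0.
have [G G0 HG] := sum_powR_of_tails q1 c0 (ler0n R 24).
have b0 i : 0 <= fine (approx_num (rhaly alpha) (2 ^ i).-1) by rewrite fine_ge0// approx_num_ge0.
(* The weight 2^i lets the value a_(2^i) stand for a whole dyadic block of approximation numbers. *)
have := HG (fun n => beta alpha n.+1 / 2) _ (fun i => 2 ^+ i) (2 * S) _ b0 _
  (fun K t t0 => rhaly_count K t0 fin) (sum_condensed q0 fin HS).
move=> /(_ (fun n => divr_ge0 (beta_ge0 alpha n.+1) (ler0n R 2))).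
move=> /(_ (fun n => exprn_ge0 n (ler0n R 2))) H.
apply/dyadic_condP; exists (beta alpha 0 `^ q + 2 `^ q * (G * (2 * S))) => -[|N].
  rewrite big_ord0 addr_ge0 ?powR_ge0// mulr_ge0 ?powR_ge0// mulr_ge0// mulr_ge0//.
  by have := HS 0%N; rewrite big_ord0.
rewrite big_ord_recl lerD2l; apply: le_trans (ler_wpM2l (powR_ge0 _ _) (H N)).
rewrite mulr_sumr; apply: ler_sum => n _.
rewrite -powRM// ?divr_ge0 ?beta_ge0// mulrC divfK ?pnatr_eq0//.
Qed.

(** * Complex power series *)

Section ComplexSeries.
Local Open Scope classical_set_scope.
Local Open Scope ring_scope.
Variable R : realType.
Local Notation C := R[i].
Implicit Types (c d : nat -> C) (l m z h : C).

Lemma normc_Re z : `|complex.Re z| <= normc z.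
Proof.
rewrite -(ler_pXn2r (ltn0Sn 1)) ?nnegrE ?normc_ge0// normc_sqr real_normK ?num_real//.
by rewrite lerDl sqr_ge0.
Qed.

Lemma normc_Im z : `|complex.Im z| <= normc z.
Proof.
rewrite -(ler_pXn2r (ltn0Sn 1)) ?nnegrE ?normc_ge0// normc_sqr real_normK ?num_real//.
by rewrite lerDr sqr_ge0.
Qed.

Lemma normc_le_ReIm z : normc z <= `|complex.Re z| + `|complex.Im z|.
Proof.
rewrite -(ler_pXn2r (ltn0Sn 1)) ?nnegrE ?normc_ge0 ?addr_ge0// normc_sqr.
rewrite sqrrD !real_normK ?num_real// lerD2r lerDl.
by rewrite mulrn_wge0// mulr_ge0.
Qed.

(* Convergence of a complex series, phrased with the real-valued modulus. *)
Definition is_csum c l := forall e : R, 0 < e ->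
  exists N0, forall N, (N0 <= N)%N -> normc (l - \sum_(n < N) c n) < e.

Lemma abs_series_cvg (u : nat -> R) S :
  (forall N, \sum_(n < N) `|u n| <= S) -> cvgn (series u).
Proof.
move=> uS; apply: normed_cvg; apply: nondecreasing_is_cvgn.
  by apply: nondecreasing_series => n _ _; exact: normr_ge0.
by exists S => _ [N _ <-]; rewrite /= /series /= big_mkord.
Qed.


Lemma Re_sum (I : Type) (s : seq I) (P : pred I) (F : I -> C) :
  complex.Re (\sum_(i <- s | P i) F i) = \sum_(i <- s | P i) complex.Re (F i).
Proof. by apply: (big_morph (@complex.Re R)) => // -[a b] [a' b']. Qed.
Lemma Im_sum (I : Type) (s : seq I) (P : pred I) (F : I -> C) :
  complex.Im (\sum_(i <- s | P i) F i) = \sum_(i <- s | P i) complex.Im (F i).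
Proof. by apply: (big_morph (@complex.Im R)) => // -[a b] [a' b']. Qed.

Lemma is_csum_ex c S : (forall N, \sum_(n < N) normc (c n) <= S) ->
  exists l, is_csum c l.
Proof.
move=> cS.
have re : cvgn (series (fun n => complex.Re (c n))).
  apply: (abs_series_cvg (S := S)) => N; apply: le_trans (cS N).
  by apply: ler_sum => n _; exact: normc_Re.
have im : cvgn (series (fun n => complex.Im (c n))).
  apply: (abs_series_cvg (S := S)) => N; apply: le_trans (cS N).
  by apply: ler_sum => n _; exact: normc_Im.
exists (limn (series (fun n => complex.Re (c n))) +i* limn (series (fun n => complex.Im (c n))))%C.
move=> e e0; have e20 : 0 < e / 2 by rewrite divr_gt0.
have /cvgrPdist_lt/(_ _ e20)[N1 _ H1] := re.
have /cvgrPdist_lt/(_ _ e20)[N2 _ H2] := im.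
exists (maxn N1 N2) => N; rewrite geq_max => /andP[N1N N2N].
apply: (le_lt_trans (normc_le_ReIm _)).
have := H1 N N1N; have := H2 N N2N.
rewrite /series /= !big_mkord -Re_sum -Im_sum.
by case: (\sum_(n < N) c n) => a b /=; lra.
Qed.

(** The norm of [C^o] is complex-valued, so the radii in its filters are complex as well; positivity
    forces them to be real. *)
Lemma normc_lt_eps z (eps : C) : 0 < eps -> (`|z| < eps) = (normc z < complex.Re eps).
Proof.
case: eps => a b; rewrite ltcE /= => /andP[/eqP -> _].
by rewrite normcE_C ltcR.
Qed.

Lemma is_csum_lim c l : is_csum c l -> limn (series (c : nat -> C^o)) = l.
Proof.
move=> cl; apply/cvg_lim; first exact: norm_hausdorff.
apply/cvgrPdist_lt => eps eps0.
have re0 : 0 < complex.Re eps by move: eps0; rewrite ltcE => /andP[].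
have [N0 HN] := cl _ re0; exists N0 => // N N0N /=.
by rewrite [X in X < _]/(`|_|) normc_lt_eps// /series /= big_mkord; exact: HN.
Qed.

Lemma is_csum_lin c d l m (a : C) : is_csum c l -> is_csum d m ->
  is_csum (fun n => a * c n + d n) (a * l + m).
Proof.
move=> cl dm e e0.
have a0 : 0 < 2 * (1 + normc a) by rewrite mulr_gt0// ltr_pwDl ?normc_ge0.
have [N1 H1] := cl _ (divr_gt0 e0 a0).
have [N2 H2] := dm _ (divr_gt0 e0 (ltr0n R 2)).
exists (maxn N1 N2) => N; rewrite geq_max => /andP[N1N N2N].
rewrite big_split /= -mulr_sumr.
have -> : a * l + m - (a * \sum_(i < N) c i + \sum_(i < N) d i) =
   a * (l - \sum_(i < N) c i) + (m - \sum_(i < N) d i) by ring.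
apply: (le_lt_trans (le_normcD _ _)); rewrite Normc.normcM.
have h1 := H1 N N1N; have h2 := H2 N N2N.
have : normc a * normc (l - \sum_(i < N) c i) <= e / 2.
  apply: (@le_trans _ _ (normc a * (e / (2 * (1 + normc a))))).
    by rewrite ler_wpM2l ?normc_ge0// ltW.
  have na := normc_ge0 a.
  rewrite mulrA ler_pdivrMr//.
  have := mulr_ge0 na (ltW e0); lra.
lra.
Qed.

Lemma is_csum_le c l S : is_csum c l -> (forall N, \sum_(n < N) normc (c n) <= S) ->
  normc l <= S.
Proof.
move=> cl cS; rewrite leNgt; apply/negP => Sl.
have [|N0 /(_ N0 (leqnn _))] := cl (normc l - S); first by rewrite subr_gt0.
have := le_normcD (l - \sum_(n < N0) c n) (\sum_(n < N0) c n).
rewrite subrK; have := normc_sum_le (index_enum 'I_N0) xpredT (fun n => c n).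
have := cS N0; lra.
Qed.

End ComplexSeries.

Section GeometricBounds.
Variable R : realType.

Lemma nat_geom_le (s : R) n : 0 <= s < 1 -> n%:R * s ^+ n <= (1 - s)^-1.
Proof.
move=> s01; apply: le_trans (geom_sum_le n s01).
rewrite -[n in n%:R]card_ord mulr_natl -sumr_const; apply: ler_sum => j _.
have /andP[s0 s1] := s01.
by apply: ler_wiXn2l => //; [exact: ltW|exact: ltnW].
Qed.

(** With t the fourth root of [r] and s = t^2, the term n^2 r^n is (n t^n)^2 s^n: a bounded factor
    times a geometric term. *)
Lemma sum_sqr_geom_le (r : R) : 0 <= r < 1 -> exists2 K, 0 <= K &
  forall N, \sum_(n < N) n%:R ^+ 2 * r ^+ n <= K.
Proof.
move=> /andP[r0 r1]; pose s := Num.sqrt r; pose t := Num.sqrt s.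
have s0 : 0 <= s by exact: sqrtr_ge0.
have s1 : s < 1 by rewrite -sqrtr1 ltr_sqrt.
have t0 : 0 <= t by exact: sqrtr_ge0.
have t1 : t < 1 by rewrite -sqrtr1 ltr_sqrt.
have rE : r = t ^+ 2 * s by rewrite sqr_sqrtr// -expr2 sqr_sqrtr.
have K0 : 0 <= (1 - t)^-1 by rewrite invr_ge0 subr_ge0 ltW.
exists ((1 - t)^-1 ^+ 2 * (1 - s)^-1).
  by rewrite mulr_ge0 ?sqr_ge0// invr_ge0 subr_ge0 ltW.
move=> N; apply: (@le_trans _ _ (\sum_(n < N) (1 - t)^-1 ^+ 2 * s ^+ n)).
  apply: ler_sum => n _; rewrite rE exprMn -exprM mulnC exprM mulrA -exprMn.
  rewrite ler_wpM2r ?exprn_ge0// ler_pXn2r ?nnegrE ?mulr_ge0 ?exprn_ge0//.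
  by rewrite nat_geom_le// t0.
by rewrite -mulr_sumr ler_wpM2l ?sqr_ge0// geom_sum_le// s0.
Qed.

End GeometricBounds.

Section PowerSeries.
Local Open Scope classical_set_scope.
Local Open Scope ring_scope.
Variable R : realType.
Local Notation C := R[i].
Variables (alpha : nat -> C) (B : R).
Hypothesis alphaB : forall n, normc (alpha n) <= B.

Lemma normcX (z : C) n : normc (z ^+ n) = normc z ^+ n.
Proof.
elim: n => [|n IH]; first by rewrite !expr0 Normc.normc1.
by rewrite !exprS Normc.normcM IH.
Qed.

Lemma normc_nat n : normc (n%:R : C) = n%:R.
Proof.
by apply: complexI; rewrite -normcE_C normr_nat rmorph_nat.
Qed.

Let B0 : 0 <= B.
Proof. exact: le_trans (normc_ge0 _) (alphaB 0). Qed.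

Lemma power_series_bound (z : C) : normc z < 1 ->
  exists S, forall N, \sum_(n < N) normc (alpha n * z ^+ n) <= S.
Proof.
move=> z1; exists (B * (1 - normc z)^-1) => N.
apply: (@le_trans _ _ (\sum_(n < N) B * normc z ^+ n)).
  apply: ler_sum => n _; rewrite Normc.normcM normcX ler_wpM2r ?exprn_ge0 ?normc_ge0//.
by rewrite -mulr_sumr ler_wpM2l// geom_sum_le// normc_ge0.
Qed.

Lemma falphaP (z : C) : normc z < 1 -> is_csum (fun n => alpha n * z ^+ n) (falpha alpha z).
Proof.
move=> /power_series_bound[S HS].
have [l Hl] := @is_csum_ex _ (fun n => alpha n * z ^+ n) _ HS.
by rewrite /falpha (is_csum_lim Hl).
Qed.

(* The n-th term of the derived series; the truncated [n.-1] is harmless at [n = 0]. *)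
Definition dcoef (z : C) n : C := n%:R * alpha n * z ^+ n.-1.

(** One majorant for both the derived series and the quadratic remainders of the binomials, whence
    the weight n^2. *)
Lemma dcoef_bound (r : R) : 0 < r < 1 ->
  exists2 S, 0 <= S & forall N, \sum_(n < N) n%:R ^+ 2 * B * r ^+ n <= S.
Proof.
move=> /andP[r0 r1].
have [|K K0 HK] := @sum_sqr_geom_le _ r; first by rewrite ltW.
exists (B * K); first by rewrite mulr_ge0.
move=> N; under eq_bigr do rewrite mulrAC mulrC.
by rewrite -mulr_sumr ler_wpM2l.
Qed.

Lemma dcoef_le (z : C) (r : R) n : normc z <= r -> 0 < r ->
  normc (dcoef z n) <= r^-1 * (n%:R ^+ 2 * B * r ^+ n).
Proof.
move=> zr r0; rewrite /dcoef !Normc.normcM normc_nat normcX.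
case: n => [|n]; first by rewrite mul0r mul0r expr0n !mul0r mulr0.
rewrite mulrCA [r ^+ _]exprS mulKf ?gt_eqF//=.
apply: ler_pM; rewrite ?mulr_ge0 ?exprn_ge0 ?normc_ge0//.
  by apply: ler_pM; rewrite ?normc_ge0// -natrX ler_nat leq_pmulr.
by rewrite lerXn2r ?nnegrE ?normc_ge0// ltW.
Qed.

Lemma dcoefP (z : C) : normc z < 1 -> exists g, is_csum (dcoef z) g.
Proof.
move=> z1; pose r := (1 + normc z) / 2.
have z0 := normc_ge0 z.
have r01 : 0 < r < 1 by apply/andP; split; rewrite /r; lra.
have zr : normc z <= r by rewrite /r; lra.
have /andP[r0 _] := r01.
have [S S0 HS] := dcoef_bound r01.
apply: (@is_csum_ex _ _ (r^-1 * S)) => N.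
apply: (@le_trans _ _ (\sum_(n < N) r^-1 * (n%:R ^+ 2 * B * r ^+ n))).
  by apply: ler_sum => n _; exact: dcoef_le.
by rewrite -mulr_sumr ler_wpM2l// invr_ge0 ltW.
Qed.

(** The remainders satisfy E_(n+1) = (z + h) E_n + n h^2 z^(n-1), and n^2 + n <= (n + 1)^2. The
    factor r^2 on the left avoids an exponent n - 2 on the right. *)
Lemma binomial_remainder_le (z h : C) (r : R) n :
  normc z <= r -> normc (z + h) <= r -> 0 < r ->
  r ^+ 2 * normc ((z + h) ^+ n - z ^+ n - n%:R * h * z ^+ n.-1) <=
  n%:R ^+ 2 * normc h ^+ 2 * r ^+ n.
Proof.
move=> zr zhr r0; elim: n => [|n IH].
  by rewrite !expr0 subrr mulr0n !mul0r subr0 Normc.normc0 mulr0 expr0n /= !mul0r.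
have -> : (z + h) ^+ n.+1 - z ^+ n.+1 - n.+1%:R * h * z ^+ n.+1.-1 =
   (z + h) * ((z + h) ^+ n - z ^+ n - n%:R * h * z ^+ n.-1) + n%:R * h ^+ 2 * z ^+ n.-1.
  case: n {IH} => [|n] /=; first by rewrite !expr0 !expr1 !mul0r; ring.
  rewrite -[n.+2%:R]natr1 !exprS; ring.
apply: (@le_trans _ _ (r ^+ 2 * (r * normc ((z + h) ^+ n - z ^+ n - n%:R * h * z ^+ n.-1) + n%:R * normc h ^+ 2 * normc z ^+ n.-1))).
  rewrite ler_wpM2l ?sqr_ge0//; apply: (le_trans (le_normcD _ _)).
  rewrite !Normc.normcM !normcX normc_nat lerD2r ler_wpM2r// normc_ge0//.
have h1 : r ^+ 2 * (n%:R * normc h ^+ 2 * normc z ^+ n.-1) <= n%:R * normc h ^+ 2 * r ^+ n.+1.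
  case: n {IH} => [|n] /=; first by rewrite !mul0r mulr0.
  rewrite mulrCA ler_wpM2l ?mulr_ge0 ?sqr_ge0 ?normc_ge0//.
  rewrite -[n.+2]add2n exprD ler_wpM2l ?sqr_ge0//.
  by rewrite lerXn2r ?nnegrE ?normc_ge0// ltW.
rewrite mulrDr mulrCA.
have h2 := ler_wpM2l (ltW r0) IH.
apply: (le_trans (lerD h2 h1)).
rewrite -natr1 [r ^+ n.+1]exprS.
have : 0 <= n%:R * (normc h ^+ 2 * (r * r ^+ n)) :> R.
  by rewrite !mulr_ge0 ?normc_ge0 ?exprn_ge0 ?(ltW r0).
have : 0 <= (normc h ^+ 2 * (r * r ^+ n)).
  by rewrite !mulr_ge0 ?normc_ge0 ?exprn_ge0 ?(ltW r0).
move: (r ^+ n) (normc h ^+ 2) (n%:R : R) => a b c ? ?; lra.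
Qed.

(** The binomial remainders, summed termwise, leave an error O(|h|^2) as long as z + h stays in a
    closed disc of radius r < 1. *)
Lemma falpha_derive (z g : C) : normc z < 1 -> is_csum (dcoef z) g ->
  is_derive (z : C^o) (1 : C^o) (falpha alpha : C^o -> C^o) (g : C^o).
Proof.
move=> z1 gP; pose r := (1 + normc z) / 2.
have z0 := normc_ge0 z.
have r01 : 0 < r < 1 by apply/andP; split; rewrite /r; lra.
have zr : normc z <= r by rewrite /r; lra.
have /andP[r0 r1] := r01.
have [S S0 HS] := dcoef_bound r01.
have est h : normc h <= r - normc z ->
    normc (falpha alpha (z + h) - falpha alpha z - h * g) <= normc h ^+ 2 * (r ^- 2 * S).
  move=> hr; have zhr : normc (z + h) <= r by apply: (le_trans (le_normcD _ _)); lra.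
  have P1 := falphaP (le_lt_trans zhr r1).
  have P2 := falphaP z1.
  have P3 := is_csum_lin (-1) P2 P1.
  have P4 := is_csum_lin (- h) gP P3.
  have -> : falpha alpha (z + h) - falpha alpha z - h * g =
    - h * g + (-1 * falpha alpha z + falpha alpha (z + h)).
    by move: (falpha alpha z) (falpha alpha (z + h)) => a b; ring.
  apply: (is_csum_le P4) => N.
  apply: (@le_trans _ _ (\sum_(n < N) normc h ^+ 2 * (r ^- 2 * (n%:R ^+ 2 * B * r ^+ n)))).
    apply: ler_sum => n _.
    have -> : - h * dcoef z n + (-1 * (alpha n * z ^+ n) + alpha n * (z + h) ^+ n) =
      alpha n * ((z + h) ^+ n - z ^+ n - n%:R * h * z ^+ n.-1) by rewrite /dcoef; ring.
    rewrite Normc.normcM.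
    have := binomial_remainder_le n zr zhr r0.
    rewrite mulrC -ler_pdivlMr ?exprn_gt0// => H.
    apply: (@le_trans _ _ (B * (n%:R ^+ 2 * normc h ^+ 2 * r ^+ n / r ^+ 2))).
      by apply: ler_pM; rewrite ?normc_ge0.
    by rewrite le_eqVlt; apply/orP; left; apply/eqP; field; rewrite gt_eqF.
  by rewrite -mulr_sumr ler_wpM2l ?sqr_ge0// -mulr_sumr ler_wpM2l// invr_ge0 exprn_ge0// ltW.
have cv : (h^-1 *: ((falpha alpha \o shift (z : C^o)) (h *: (1 : C^o)) - falpha alpha z) : C^o) @[h --> (0 : C^o)^'] --> (g : C^o).
  apply/cvgrPdist_lt => eps eps0.
  have re0 : 0 < complex.Re eps by move: eps0; rewrite ltcE => /andP[].
  have K0 : 0 < 1 + r ^- 2 * S.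
    by rewrite ltr_pwDl// mulr_ge0// invr_ge0 exprn_ge0// ltW.
  (* The first bound keeps z + h in the disc of radius [r]; the second makes the O(|h|) error of the
     quotient smaller than [eps], the added 1 avoiding a zero denominator. *)
  pose d := Num.min (r - normc z) (complex.Re eps / (1 + r ^- 2 * S)).
  have d0 : 0 < d by rewrite lt_min divr_gt0// andbT /r; lra.
  exists (d%:C)%C; first by rewrite /= ltcR.
  move=> h /=; rewrite sub0r normrN normcE_C ltcR lt_min => /andP[h1 h2] hn0.
  rewrite [X in X < _]/(`|_|) normc_lt_eps//.
  have hc0 : normc h != 0 by apply/eqP => /Normc.eq0_normc; apply/eqP.
  have hgt : 0 < normc h by rewrite lt_neqAle eq_sym hc0 normc_ge0.
  have -> : g - h^-1 *: (falpha alpha (h *: (1 : C^o) + z) - falpha alpha z) =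
    - (h^-1 * (falpha alpha (z + h) - falpha alpha z - h * g)).
    rewrite [h *: _]mulr1 [h + z]addrC.
    have sc (a b : C) : a *: (b : C^o) = a * b by [].
    rewrite sc; move: (falpha alpha z) (falpha alpha (z + h)) => a b.
    by field; exact: hn0.
  rewrite normc_opp Normc.normcM Normc.normcV.
  apply: (@le_lt_trans _ _ ((normc h)^-1 * (normc h ^+ 2 * (r ^- 2 * S)))).
    by rewrite ler_wpM2l ?invr_ge0 ?normc_ge0// est// ltW.
  rewrite expr2 -mulrA mulKf//.
  rewrite ltr_pdivlMr// in h2; apply: le_lt_trans h2.
  by rewrite ler_wpM2l ?normc_ge0// lerDr.
apply: DeriveDef; first by apply/cvg_ex; exists g.
by apply/cvg_lim; [exact: norm_hausdorff|exact: cv].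
Qed.

Lemma falpha_holomorphic : holomorphic_on_disc (falpha alpha).
Proof.
move=> z z1; have [g gP] := dcoefP z1.
by have [] := falpha_derive z1 gP.
Qed.

Lemma cderiv_falpha (z : C) : normc z < 1 -> is_csum (dcoef z) (cderiv (falpha alpha) z).
Proof.
move=> z1; have [g gP] := dcoefP z1.
by rewrite /cderiv; have [_ ->] := falpha_derive z1 gP.
Qed.

End PowerSeries.

(** * Parseval on circles *)

Section Parseval.
Local Open Scope classical_set_scope.
Local Open Scope ring_scope.
Variable R : realType.
Local Notation C := R[i].

Lemma deMoivre (t : R) n :
  (cos t +i* sin t)%C ^+ n = (cos (n%:R * t) +i* sin (n%:R * t))%C.
Proof.
elim: n => [|n IH]; first by rewrite expr0 mul0r cos0 sin0.
rewrite exprS IH -natr1 mulrDl mul1r cosD sinD.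
by apply/eqP; rewrite eq_complex /=; apply/andP; split; apply/eqP; ring.
Qed.

Lemma cos_sin_nat2pi n : cos (n%:R * (2 * pi)) = 1 :> R /\ sin (n%:R * (2 * pi)) = 0 :> R.
Proof.
elim: n => [|n [c s]]; first by rewrite mul0r cos0 sin0.
have e : 2 * pi = pi *+ 2 :> R by rewrite mulr_natl.
by rewrite -natr1 mulrDl mul1r cosD sinD c s e cos2pi sin2pi !(mul1r, mul0r, mulr0, addr0) subr0.
Qed.

Lemma cos_sin_diff2pi n m : cos ((n%:R - m%:R) * (2 * pi)) = 1 :> R /\
  sin ((n%:R - m%:R) * (2 * pi)) = 0 :> R.
Proof.
have [c s] := cos_sin_nat2pi n; have [c' s'] := cos_sin_nat2pi m.
by rewrite mulrBl cosB sinB c s c' s' !(mul1r, mul0r, mulr0, addr0) subr0.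
Qed.

(** The real part of c_n conj(c_m) e^(i(n-m)t) for c = x + iy. *)
Definition trig_term (x y : nat -> R) n m (t : R) : R :=
  (x n * x m + y n * y m) * cos ((n%:R - m%:R) * t) +
  (x n * y m - y n * x m) * sin ((n%:R - m%:R) * t).

(** Antiderivative of [trig_term]. Off the diagonal it is 2 pi-periodic, so over a full circle only
    the diagonal contributes. *)
Definition trig_prim (x y : nat -> R) n m (t : R) : R :=
  if n == m then (x n ^+ 2 + y n ^+ 2) * t else
  (x n * x m + y n * y m) / (n%:R - m%:R) * sin ((n%:R - m%:R) * t) -
  (x n * y m - y n * x m) / (n%:R - m%:R) * cos ((n%:R - m%:R) * t).

Lemma normc_trig_poly (c : nat -> C) N t :
  normc (\sum_(n < N) c n * (cos t +i* sin t)%C ^+ n) ^+ 2 =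
  \sum_(n < N) \sum_(m < N)
    trig_term (fun n => complex.Re (c n)) (fun n => complex.Im (c n)) n m t.
Proof.
rewrite normc_sqr Re_sum Im_sum !expr2 !big_distrlr -big_split /=.
apply: eq_bigr => n _; rewrite -big_split /=; apply: eq_bigr => m _.
rewrite !deMoivre /trig_term mulrBl cosB sinB.
by case: (c n) => a b; case: (c m) => a' b' /=; ring.
Qed.

Lemma is_derive_scale (k t : R) : is_derive t 1 (fun t => k * t) k.
Proof.
have := is_deriveZ k (is_derive_id t (1 : R)).
by rewrite [_ *: _]mulr1.
Qed.

Lemma is_derive_sin_scale (k t : R) : is_derive t 1 (fun t => sin (k * t)) (cos (k * t) * k).
Proof. exact: is_derive1_comp (is_derive_sin _) (is_derive_scale k t). Qed.

Lemma is_derive_cos_scale (k t : R) : is_derive t 1 (fun t => cos (k * t)) (- sin (k * t) * k).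
Proof. exact: is_derive1_comp (is_derive_cos _) (is_derive_scale k t). Qed.

Lemma is_derive_trig_prim x y n m (t : R) :
  is_derive t 1 (trig_prim x y n m) (trig_term x y n m t).
Proof.
rewrite /trig_prim; case: eqVneq => [->|nm].
  have -> : trig_term x y m m t = x m ^+ 2 + y m ^+ 2.
    by rewrite /trig_term subrr mul0r cos0 sin0; ring.
  exact: is_derive_scale.
have w0 : n%:R - m%:R != 0 :> R by rewrite subr_eq0 eqr_nat.
rewrite (_ : trig_term x y n m t =
    (x n * x m + y n * y m) / (n%:R - m%:R) * (cos ((n%:R - m%:R) * t) * (n%:R - m%:R)) -
    (x n * y m - y n * x m) / (n%:R - m%:R) * (- sin ((n%:R - m%:R) * t) * (n%:R - m%:R))).
  exact: (is_deriveB
    (is_deriveZ ((x n * x m + y n * y m) / (n%:R - m%:R)) (is_derive_sin_scale (n%:R - m%:R) t))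
    (is_deriveZ ((x n * y m - y n * x m) / (n%:R - m%:R)) (is_derive_cos_scale (n%:R - m%:R) t))).
by rewrite /trig_term; field.
Qed.

Lemma is_derive_trig_term x y n m (t : R) : exists l, is_derive t 1 (trig_term x y n m) l.
Proof.
exists ((x n * x m + y n * y m) * (- sin ((n%:R - m%:R) * t) * (n%:R - m%:R)) +
 (x n * y m - y n * x m) * (cos ((n%:R - m%:R) * t) * (n%:R - m%:R))).
exact: (is_deriveD (is_deriveZ (x n * x m + y n * y m) (is_derive_cos_scale (n%:R - m%:R) t))
  (is_deriveZ (x n * y m - y n * x m) (is_derive_sin_scale (n%:R - m%:R) t))).
Qed.

Lemma is_derive_sum2 N (F dF : nat -> nat -> R -> R) (t : R) :
  (forall n m, is_derive t 1 (F n m) (dF n m t)) ->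
  is_derive t 1 (fun t => \sum_(n < N) \sum_(m < N) F n m t)
    (\sum_(n < N) \sum_(m < N) dF n m t).
Proof.
move=> HF.
have -> : (fun t => \sum_(n < N) \sum_(m < N) F n m t) = \sum_(n < N) \sum_(m < N) F n m.
  rewrite fct_sumE; apply: funext => s; apply: eq_bigr => n _.
  by rewrite fct_sumE.
by apply: is_derive_sum => n; apply: is_derive_sum => m.
Qed.

Lemma integral_trig_poly (c : nat -> C) N :
  (\int[lebesgue_measure]_(t in `[0%R, (2 * pi)%R])
    (normc (\sum_(n < N) c n * (cos t +i* sin t)%C ^+ n) ^+ 2)%:E =
  (\sum_(n < N) 2 * pi * normc (c n) ^+ 2)%:E)%E.
Proof.
pose x n := complex.Re (c n); pose y n := complex.Im (c n).
pose f t := \sum_(n < N) \sum_(m < N) trig_term x y n m t.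
pose F t := \sum_(n < N) \sum_(m < N) trig_prim x y n m t.
have -> : (\int[lebesgue_measure]_(t in `[0%R, (2 * pi)%R])
    (normc (\sum_(n < N) c n * (cos t +i* sin t)%C ^+ n) ^+ 2)%:E =
   \int[lebesgue_measure]_(t in `[0%R, (2 * pi)%R]) (f t)%:E)%E.
  by apply: eq_integral => t _; rewrite normc_trig_poly.
have dF (t : R) : is_derive t 1 F (f t) by apply: is_derive_sum2 => n m; exact: is_derive_trig_prim.
have cont (G : R -> R) : (forall t : R, derivable G t 1) -> continuous G.
  move=> dG t; apply: differentiable_continuous; apply/derivable1_diffP; exact: dG.
have dF' (t : R) : derivable F t 1 by have [] := dF t.
have df (t : R) : derivable f t 1.
  have [df Hdf] : exists df : nat -> nat -> R -> R, forall n m, is_derive t 1 (trig_term x y n m) (df n m t).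
    have [g Hg] := choice (fun nm : nat * nat => is_derive_trig_term x y nm.1 nm.2 t).
    by exists (fun n m _ => g (n, m)) => n m; exact: (Hg (n, m)).
  by have [] := is_derive_sum2 N Hdf.
have pi0 : 0 < 2 * pi :> R by rewrite mulr_gt0 ?pi_gt0.
rewrite (@continuous_FTC2 _ f F) //; last 3 first.
- by apply: continuous_subspaceT; exact: cont.
- split; first by move=> t _; exact: dF'.
  + by apply: cvg_at_right_filter; exact: cont.
  + by apply: cvg_at_left_filter; exact: cont.
- by move=> t _; rewrite derive1E; have [_ ->] := dF t.
rewrite -EFinB; congr (_%:E).
rewrite /F -sumrB; apply: eq_bigr => n _; rewrite -sumrB.
rewrite (bigD1 n)//= big1 ?addr0.
  by rewrite /trig_prim eqxx normc_sqr mulr0 subr0 mulrC.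
move=> m mn; rewrite /trig_prim eq_sym; rewrite -val_eqE in mn.
rewrite (negbTE mn).
have [-> ->] := cos_sin_diff2pi n m.
by rewrite !mulr0 cos0 sin0; ring.
Qed.

End Parseval.

Section CircleIntegral.
Local Open Scope classical_set_scope.
Local Open Scope ring_scope.
Variable R : realType.
Local Notation C := R[i].
Variables (alpha : nat -> C) (B : R).
Hypothesis alphaB : forall n, normc (alpha n) <= B.

(* The squared modulus of the n-th Fourier coefficient of the derivative on the circle. *)
Definition dmass (r : R) n : R := n.+1%:R ^+ 2 * normc (alpha n.+1) ^+ 2 * r ^+ n.*2.

(** The partial sums of the derivative are trigonometric polynomials on the circle, bounded by one
    constant [G]; dominated convergence carries Parseval from them to the limit. *)
Lemma circle_int_falpha (r : R) : 0 < r < 1 ->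
  circle_int (falpha alpha) r = (\sum_(0 <= n <oo) (2 * pi * dmass r n)%:E)%E.
Proof.
move=> r01; have /andP[r0 r1] := r01.
have [S S0 HS] := dcoef_bound alphaB r01.
pose c n : C := n.+1%:R * alpha n.+1 * (r%:C)%C ^+ n.
pose p (t : R) : C := (cos t +i* sin t)%C.
have normp t : normc (p t) = 1 by rewrite /= cos2Dsin2 sqrtr1.
have normrp t : normc ((r%:C)%C * p t) = r.
  by rewrite Normc.normcM normp mulr1 normc_real gtr0_norm.
(* The derived series has a zero term at index 0, so [N] terms of [c] are N + 1 terms of [dcoef]. *)
have cE N t : \sum_(n < N) c n * p t ^+ n = \sum_(n < N.+1) dcoef alpha ((r%:C)%C * p t) n.
  rewrite big_ord_recl /= {1}/dcoef mul0r mul0r add0r; apply: eq_bigr => n _.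
  by rewrite /dcoef /c /bump /= add1n exprMn mulrA.
pose G := r^-1 * S.
have G0 : 0 <= G by rewrite mulr_ge0// invr_ge0 ltW.
have dcG t N : \sum_(n < N) normc (dcoef alpha ((r%:C)%C * p t) n) <= G.
  apply: (@le_trans _ _ (\sum_(n < N) r^-1 * (n%:R ^+ 2 * B * r ^+ n))).
    by apply: ler_sum => n _; apply: dcoef_le; rewrite ?normrp.
  by rewrite -mulr_sumr ler_wpM2l// invr_ge0 ltW.
pose h (t : R) := cderiv (falpha alpha) ((r%:C)%C * p t).
have hP t : is_csum (dcoef alpha ((r%:C)%C * p t)) (h t).
  by apply: (cderiv_falpha alphaB); rewrite normrp.
pose hN N (t : R) := \sum_(n < N) c n * p t ^+ n.
have hNG N t : normc (hN N t) <= G.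
  by rewrite /hN cE; apply: le_trans (dcG t N.+1); exact: normc_sum_le.
have hG t : normc (h t) <= G by exact: (is_csum_le (hP t) (dcG t)).
have cv (t : R) : (normc (hN N t) ^+ 2)%:E @[N --> \oo] --> (normc (h t) ^+ 2)%:E.
  apply: cvg_EFin; first by apply: nearW => N.
  apply/cvgrPdist_lt => e e0.
  have k0 : 0 < 2 * G + 1 by rewrite ltr_wpDl// mulr_ge0.
  have [N0 HN0] := hP t _ (divr_gt0 e0 k0).
  exists N0 => // N N0N /=.
  have := HN0 N.+1 (leqW N0N); rewrite -cE -/(hN N t) ltr_pdivlMr// => H.
  have d1 : `|normc (h t) - normc (hN N t)| <= normc (h t - hN N t).
    rewrite ler_norml; have := le_normcD (h t - hN N t) (hN N t).
    have := le_normcD (- (h t - hN N t)) (h t).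
    rewrite subrK opprB subrK -opprB normc_opp; lra.
  rewrite subr_sqr normrM; apply: le_lt_trans H.
  apply: ler_pM; rewrite ?normr_ge0//.
  rewrite ger0_norm ?addr_ge0 ?normc_ge0//.
  have := hNG N t; have := hG t; lra.
have mh N : measurable_fun `[0%R, (2 * pi)%R] (fun t => (normc (hN N t) ^+ 2)%:E).
  apply/measurable_EFinP; apply: measurable_funTS.
  rewrite (_ : (fun t => _) = (fun t => \sum_(n < N) \sum_(m < N)
    trig_term (fun n => complex.Re (c n)) (fun n => complex.Im (c n)) n m t)); last first.
    by apply: funext => t; rewrite /hN normc_trig_poly.
  apply: measurable_sum => n; apply: measurable_sum => m.
  apply: continuous_measurable_fun => t.
  apply: differentiable_continuous; apply/derivable1_diffP.
  by have [l []] := is_derive_trig_term (fun n => complex.Re (c n)) (fun n => complex.Im (c n)) n m t.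
have ig : lebesgue_measure.-integrable `[0%R, (2 * pi)%R] (fun=> (G ^+ 2)%:E).
  apply/integrableP; split; first exact: measurable_cst.
  rewrite integral_cst//= lebesgue_measure_itv /= lte_fin mulr_gt0 ?pi_gt0//.
  by rewrite -EFinD -EFinM ltry.
have := @dominated_cvg _ _ _ lebesgue_measure `[0%R, (2 * pi)%R] _
  (fun N t => (normc (hN N t) ^+ 2)%:E) (fun t => (normc (h t) ^+ 2)%:E) (fun=> (G ^+ 2)%:E) mh
  (fun t _ => cv t) (fun t _ => isT) ig.
have -> : (fun N => (\int[lebesgue_measure]_(t in `[0%R, (2 * pi)%R]) (normc (hN N t) ^+ 2)%:E)%E) =
  (fun N => (\sum_(0 <= n < N) (2 * pi * dmass r n)%:E)%E).
  apply: funext => N; rewrite integral_trig_poly sumEFin big_mkord; congr (_%:E).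
  apply: eq_bigr => n _; congr (_ * _).
  rewrite /c !Normc.normcM normc_nat normcX /dmass !exprMn -exprM muln2.
  by rewrite normc_real gtr0_norm.
move=> H; apply/esym/cvg_lim; first exact: ereal_hausdorff.
apply: H => [//|N t _].
rewrite lee_fin ger0_norm ?sqr_ge0// ler_pXn2r ?nnegrE ?normc_ge0//.
Qed.

End CircleIntegral.

(** * The Besov integral *)

Section RealBounds.
Local Open Scope classical_set_scope.
Local Open Scope ring_scope.
Variable R : realType.

Lemma Bernoulli_le (x : R) u : -1 <= x -> 1 + u%:R * x <= (1 + x) ^+ u.
Proof.
move=> x1; elim: u => [|u IH]; first by rewrite mul0r addr0 expr0.
have x10 : 0 <= 1 + x by lra.
rewrite exprS; apply: le_trans (ler_wpM2l x10 IH).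
rewrite -natr1; have : 0 <= u%:R * (x * x) by rewrite mulr_ge0// -expr2 sqr_ge0.
lra.
Qed.

(** For m < n it is enough that r <= 1. Otherwise, with d = m - n and x = 2^-(n+1), r (1 + x) <= 1
    and Bernoulli give r^(2^m - 1) <= 2 / 2^d. Of the two factors 2^-d in its square, one offsets
    the growth of 2^(m+1) and the other is the decay. *)
Lemma radial_weight_le (r : R) n m : 0 < r -> r <= 1 - 2 ^- n.+1 ->
  2 ^+ m.+1 * r ^+ (2 ^ m - 1).*2 <= 16 * 2 ^+ n * 2^-1 ^+ (n - m.+1 + (m.+1 - n)).
Proof.
move=> r0 rx; set x := 2 ^- n.+1 in rx.
have x0 : 0 < x by rewrite invr_gt0 exprn_gt0.
have r1 : r <= 1 by lra.
have p0 k : 0 < 2 ^+ k :> R by rewrite exprn_gt0.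
have [mn|nm] := leqP m.+1 n.
  have -> : (m.+1 - n = 0)%N by lia.
  rewrite addn0 exprVn.
  have -> : 16 * 2 ^+ n * 2 ^- (n - m.+1) = 16 * 2 ^+ m.+1 :> R.
    by rewrite -{1}(subnKC mn) exprD mulrA mulfK// gt_eqF.
  have rk : r ^+ (2 ^ m - 1).*2 <= 1 by rewrite exprn_ile1// ltW.
  have := ler_wpM2l (ltW (p0 m.+1)) rk; have := p0 m.+1; lra.
have -> : (n - m.+1 = 0)%N by lia.
rewrite add0n; set u := (2 ^ m - 1)%N.
have uE : u%:R = 2 ^+ m - 1 :> R by rewrite /u natrB ?expn_gt0// natrX.
pose d := (m - n)%N.
have -> : (m.+1 - n = d.+1)%N by rewrite /d; lia.
have mE : m = (n + d)%N by rewrite /d; lia.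
have xd : 2 ^+ m * x = 2 ^+ d / 2.
  by rewrite /x mE exprD exprS; field; rewrite gt_eqF.
have x1 : x <= 1.
  by rewrite /x invf_le1// exprn_ege1// ler1n.
have b1 : 2 ^+ d / 2 <= (1 + x) ^+ u.
  apply: le_trans (Bernoulli_le u _); last lra.
  rewrite uE mulrBl xd; lra.
have ru : r ^+ u * (1 + x) ^+ u <= 1.
  have x10 : 0 <= 1 + x by lra.
  rewrite -exprMn; apply: exprn_ile1; first by rewrite mulr_ge0// ltW.
  have : 0 <= (1 - x - r) * (1 + x) by rewrite mulr_ge0; lra.
  have : 0 <= x * x by rewrite mulr_ge0// ltW.
  lra.
have ru' : r ^+ u <= 2 / 2 ^+ d.
  rewrite ler_pdivlMr//; have := ler_wpM2l (exprn_ge0 u (ltW r0)) b1; lra.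
have ru2 : r ^+ u.*2 <= 4 / (2 ^+ d * 2 ^+ d).
  rewrite -mul2n mulnC exprM.
  have : r ^+ u ^+ 2 <= (2 / 2 ^+ d) ^+ 2.
    by rewrite ler_pXn2r ?nnegrE ?exprn_ge0 ?divr_ge0 ?(ltW r0) ?(ltW (p0 d)).
  move=> /le_trans; apply; rewrite le_eqVlt; apply/orP; left; apply/eqP.
  by field; rewrite gt_eqF.
have := ler_wpM2l (ltW (p0 m.+1)) ru2 => /le_trans; apply.
rewrite mE -addnS exprD exprVn exprS.
have -> : 2 ^+ n * (2 * 2 ^+ d) * (4 / (2 ^+ d * 2 ^+ d)) = 8 * 2 ^+ n / 2 ^+ d :> R.
  by field; rewrite gt_eqF.
have -> : 16 * 2 ^+ n * (2 * 2 ^+ d)^-1 = 8 * 2 ^+ n / 2 ^+ d :> R.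
  by field; rewrite gt_eqF.
by [].
Qed.

(** Bernoulli gives r^(2^n) >= 1/2, and 2j <= 4 * 2^n, whence (1/2)^4. *)
Lemma radial_weight_ge (r : R) n j : 0 < r < 1 -> 1 - 2 ^- n.+1 < r ->
  (j <= 2 ^ n.+1)%N -> 16^-1 <= r ^+ j.*2.
Proof.
move=> /andP[r0 r1] rn jn.
have y1 : 2 ^- n.+1 <= 1 :> R by rewrite invf_le1 ?exprn_gt0// exprn_ege1// ler1n.
have h : 2^-1 <= r ^+ (2 ^ n).
  apply: (@le_trans _ _ ((1 - 2 ^- n.+1) ^+ (2 ^ n))).
    apply: le_trans (@Bernoulli_le (- 2 ^- n.+1) _ _); last by lra.
    rewrite natrX mulrN exprS invfM mulrCA mulfV ?gt_eqF ?exprn_gt0//; lra.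
  by rewrite lerXn2r ?nnegrE ?subr_ge0 ?(ltW r0)// ltW.
apply: (@le_trans _ _ (r ^+ (2 ^ n * 4))).
  rewrite exprM (_ : 16^-1 = 2^-1 ^+ 4 :> R); last by field.
  by rewrite ler_pXn2r ?nnegrE ?exprn_ge0 ?(ltW r0)// invr_ge0.
apply: ler_wiXn2l; [exact: ltW|exact: ltW|].
by move: jn; rewrite expnS; lia.
Qed.

(** Passage to infinite convolutions: [w n] is twice a partial sum chosen within a factor 2 of the
    supremum, so that the finite inequality still applies to any [N] of them. *)
Lemma geometric_convolution_sup (p r : R) : 0 < p -> 0 <= r < 1 ->
  exists2 C : R, 0 <= C & forall (x : nat -> R) S, (forall n, 0 <= x n) ->
    (forall N, \sum_(k < N) x k `^ p <= S) ->
    exists w : nat -> R, [/\ forall n, 0 <= w n,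
      forall n K, \sum_(k < K) r ^+ (n - k + (k - n)) * x k <= w n &
      forall N, \sum_(n < N) w n `^ p <= C * S].
Proof.
move=> p0 r01; have /andP[r0 r1] := r01.
have [C C0 HC] := geometric_convolution p0 r01.
exists (2 `^ p * C); first by rewrite mulr_ge0 ?powR_ge0.
move=> x S x0 HS.
pose W n K := \sum_(k < K) r ^+ (n - k + (k - n)) * x k.
have W_mono n a b : (a <= b)%N -> W n a <= W n b.
  move=> ab; rewrite /W -(big_mkord xpredT (fun k => r ^+ (n - k + (k - n)) * x k)).
  rewrite -(big_mkord xpredT (fun k => r ^+ (n - k + (k - n)) * x k)).
  rewrite (@big_cat_nat _ _ _ a 0 b)//= lerDl sumr_ge0// => k _.
  by rewrite mulr_ge0 ?exprn_ge0.
have W0 n K : 0 <= W n K by apply: sumr_ge0 => k _; rewrite mulr_ge0 ?exprn_ge0.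
have xS k : x k <= S `^ p^-1.
  have xp : x k `^ p <= S.
    apply: le_trans (HS k.+1); rewrite big_ord_recr /= lerDr sumr_ge0// => i _.
    exact: powR_ge0.
  have := le_powR2r (ltW (_ : 0 < p^-1)) (powR_ge0 _ _) xp.
  by rewrite -powRrM mulfV ?gt_eqF// powRr1//; apply; rewrite invr_gt0.
have Wb n K : W n K <= 2 / (1 - r) * S `^ p^-1.
  apply: le_trans (ler_wpM2r (powR_ge0 _ _) (sum_geom_dist n K r01)).
  by rewrite mulr_suml; apply: ler_sum => k _; rewrite ler_wpM2l ?exprn_ge0.
have ex n : exists K, forall K', W n K' <= 2 * W n K.
  have hs : has_sup [set W n K | K in setT].
    split; first by exists (W n 0%N); exists 0%N.
    by exists (2 / (1 - r) * S `^ p^-1) => _ [K _ <-].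
  have [s0|s0] := leP (sup [set W n K | K in setT]) 0.
    exists 0%N => K'; apply: (@le_trans _ _ 0); last by rewrite mulr_ge0.
    by apply: le_trans s0; apply: sup_upper_bound => //; exists K'.
  have [|_ [K _ <-] HK] := @sup_adherent _ _ (sup [set W n K | K in setT] / 2) _ hs.
    by rewrite divr_gt0.
  exists K => K'; apply: (@le_trans _ _ (sup [set W n K | K in setT])).
    by apply: sup_upper_bound => //; exists K'.
  lra.
have [Kf HK] := choice ex.
exists (fun n => 2 * W n (Kf n)); split.
- by move=> n; rewrite mulr_ge0.
- by move=> n K; exact: HK.
(* One truncation beyond [N] and beyond all the chosen [Kf n] with n < N. *)
move=> N; pose M := (N + \sum_(n < N) Kf n)%N.
apply: (@le_trans _ _ (\sum_(n < M) 2 `^ p * W n M `^ p)).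
  rewrite -(big_mkord xpredT (fun n => (2 * W n (Kf n)) `^ p)).
  rewrite -(big_mkord xpredT (fun n => 2 `^ p * W n M `^ p)).
  rewrite (@big_cat_nat _ _ _ N 0 M) ?leq_addr//= ler_wpDr//.
    by apply: sumr_ge0 => n _; rewrite mulr_ge0 ?powR_ge0.
  rewrite [leLHS]big_nat [leRHS]big_nat; apply: ler_sum => n /andP[_ nN].
  rewrite -powRM// le_powR2r ?mulr_ge0// ?(ltW p0)// ler_pM2l//.
  apply: W_mono; rewrite /M (bigD1 (Ordinal nN))//=; lia.
rewrite -mulr_sumr -mulrA ler_wpM2l ?powR_ge0//.
by apply: le_trans (HC x M x0) _; rewrite ler_wpM2l.
Qed.

End RealBounds.

Section Besov.
Local Open Scope classical_set_scope.
Local Open Scope ring_scope.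
Variable R : realType.
Local Notation C := R[i].
Variable alpha : seqC R.

(** On [I_(m+1)] one factor of j^2 <= 2^(m+1) * 2^(m+1) turns the mass into beta^2, and the other
    goes into [radial_weight_le]. *)
Lemma sum_dmass_le (r : R) n K : 0 < r -> r <= 1 - 2 ^- n.+1 ->
  \sum_(k < K) dmass alpha r k <=
  16 * 2 ^+ n * \sum_(m < K.+2) 2^-1 ^+ (n - m + (m - n)) * beta alpha m ^+ 2.
Proof.
move=> r0 rn.
pose T (j : nat) := j%:R ^+ 2 * normc (alpha j) ^+ 2 * r ^+ (j.-1).*2.
have T0 j : 0 <= T j.
  by apply: mulr_ge0; [apply: mulr_ge0; exact: sqr_ge0|apply: exprn_ge0; exact: ltW].
apply: (@le_trans _ _ (\sum_(j < K.+1) T j)).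
  by rewrite [leRHS]big_ord_recl /= ler_wpDl.
apply: (le_trans (sum_ord_le_blocks K.+1 T0)).
rewrite mulr_sumr; apply: ler_sum => -[[|m] mK] _ /=.
  rewrite big_nat1 /T expr0n !mul0r.
  have h2 : 0 <= 2^-1 :> R by rewrite invr_ge0.
  apply: mulr_ge0; first by rewrite mulr_ge0// exprn_ge0.
  by apply: mulr_ge0; [exact: exprn_ge0|exact: sqr_ge0].
apply: (@le_trans _ _ (2 ^+ m.+1 * r ^+ (2 ^ m - 1).*2 * beta alpha m.+1 ^+ 2)); last first.
  by rewrite mulrA ler_wpM2r ?sqr_ge0//; exact: radial_weight_le.
rewrite beta_sqr mulrA mulr_sumr [leLHS]big_nat [leRHS]big_nat.
apply: ler_sum => j /andP[mj jm].
rewrite /T.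
have r1 : r <= 1.
  have : 0 < 2 ^- n.+1 :> R by rewrite invr_gt0 exprn_gt0.
  by move: rn; lra.
have h1 : j%:R ^+ 2 <= 2 ^+ m.+1 * 2 ^+ m.+1 :> R.
  by rewrite -expr2 ler_pXn2r ?nnegrE ?exprn_ge0// -natrX ler_nat ltnW.
have h2 : r ^+ (j.-1).*2 <= r ^+ (2 ^ m - 1).*2.
  by apply: ler_wiXn2l; [exact: ltW|exact: r1|lia].
have a0 : 0 <= normc (alpha j) ^+ 2 by rewrite sqr_ge0.
apply: (@le_trans _ _ (2 ^+ m.+1 * 2 ^+ m.+1 * normc (alpha j) ^+ 2 * r ^+ (2 ^ m - 1).*2)).
  apply: ler_pM; [|by apply: exprn_ge0; exact: ltW| |exact: h2].
    by apply: mulr_ge0 => //; exact: sqr_ge0.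
  exact: ler_wpM2r.
by rewrite le_eqVlt; apply/orP; left; apply/eqP; ring.
Qed.

(** Only [I_(n+1)] is kept, where j^2 >= 4^(n+1) / 4; with the radial 1/16 this makes 64. *)
Lemma sum_dmass_ge (r : R) n : 0 < r < 1 -> 1 - 2 ^- n.+1 < r ->
  2 ^+ n.+1 * beta alpha n.+1 ^+ 2 / 64 <= \sum_(k < 2 ^ n.+1) dmass alpha r k.
Proof.
move=> r01 rn; have /andP[r0 r1] := r01.
pose T (j : nat) := j%:R ^+ 2 * normc (alpha j) ^+ 2 * r ^+ (j.-1).*2.
have T0 j : 0 <= T j.
  by apply: mulr_ge0; [apply: mulr_ge0; exact: sqr_ge0|apply: exprn_ge0; exact: ltW].
have -> : \sum_(k < 2 ^ n.+1) dmass alpha r k = \sum_(1 <= j < (2 ^ n.+1).+1) T j.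
  by rewrite big_add1 /= big_mkord.
rewrite (@big_cat_nat _ _ _ (dy n.+1) 1 _)/=; last 2 first.
- by rewrite expn_gt0.
- by rewrite leqW// leq_exp2l.
rewrite ler_wpDl ?sumr_ge0//.
rewrite (@big_cat_nat _ _ _ (dy n.+2) (2 ^ n) _)/=; last 2 first.
- by rewrite leq_exp2l.
- exact: leqnSn.
rewrite ler_wpDr ?sumr_ge0//.
rewrite beta_sqr mulrA /mass mulr_sumr mulr_suml [leLHS]big_nat [leRHS]big_nat.
apply: ler_sum => j /andP[nj jn]; rewrite /T.
have h1 : 2 ^+ n * 2 ^+ n <= j%:R ^+ 2 :> R.
  by rewrite -expr2 ler_pXn2r ?nnegrE ?exprn_ge0// -natrX ler_nat.
have h2 : 16^-1 <= r ^+ (j.-1).*2.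
  by apply: (radial_weight_ge r01 rn); move: jn; rewrite dyS; lia.
have a0 : 0 <= normc (alpha j) ^+ 2 by rewrite sqr_ge0.
apply: (@le_trans _ _ (2 ^+ n * 2 ^+ n * normc (alpha j) ^+ 2 * 16^-1)).
  by rewrite exprS le_eqVlt; apply/orP; left; apply/eqP; field.
apply: ler_pM; [|by rewrite invr_ge0|exact: ler_wpM2r|exact: h2].
by apply: mulr_ge0 => //; rewrite mulr_ge0 ?exprn_ge0.
Qed.


Definition annulus n : set R := `](1 - 2 ^- n)%R, (1 - 2 ^- n.+1)%R]%classic.

Lemma annulusP n r : annulus n r -> 1 - 2 ^- n < r <= 1 - 2 ^- n.+1.
Proof. by rewrite /annulus /= in_itv. Qed.

Lemma half_pow_bounds n : 0 < 2 ^- n :> R /\ 2 ^- n <= 1 :> R.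
Proof. by rewrite invr_gt0 exprn_gt0// invf_le1 ?exprn_gt0// exprn_ege1// ler1n. Qed.

Lemma annulus_sub n r : annulus n r -> 0 < r < 1.
Proof.
move=> /annulusP/andP[a b].
have [_ y1] := half_pow_bounds n; have [z0 _] := half_pow_bounds n.+1.
apply/andP; split; lra.
Qed.

Lemma measurable_annulus n : measurable (annulus n).
Proof. exact: measurable_itv. Qed.

Lemma annulus_measure n : lebesgue_measure (annulus n) = (2 ^- n.+1)%:E.
Proof.
rewrite lebesgue_measure_itv /= lte_fin.
have -> : 1 - 2 ^- n < 1 - 2 ^- n.+1 :> R.
  rewrite ltrD2l ltrN2 ltf_pV2 ?posrE ?exprn_gt0// exprS.
  have : 0 < 2 ^+ n :> R by rewrite exprn_gt0.
  lra.
rewrite -EFinD; congr (_%:E).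
by rewrite exprS; field; rewrite gt_eqF// exprn_gt0.
Qed.

Lemma bigcup_annulus : \bigcup_n annulus n = `]0%R, 1%R[%classic :> set R.
Proof.
apply/seteqP; split=> r /=.
  by move=> [n _ /annulus_sub]; rewrite in_itv.
rewrite in_itv /= => /andP[r0 r1].
have ex : exists n, 2 ^- n.+1 <= 1 - r.
  exists (Num.truncn (1 - r)^-1).
  have x0 : 0 < 1 - r by lra.
  rewrite -[leRHS]invrK lef_pV2 ?posrE ?invr_gt0 ?exprn_gt0//.
  apply: (le_trans (ltW (truncnS_gt _))); rewrite -natrX ler_nat ltnW// ltn_expl//.
have := ex_minnP ex; case: ex_minn => n hn nmin _ || move=> [n hn nmin].
exists n => //; rewrite /annulus /= in_itv /=; apply/andP; split; last by lra.
case: n hn nmin => [|n] hn nmin; first by rewrite expr0 invr1; lra.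
have : ~ (2 ^- n.+1 <= 1 - r) by move=> /nmin; rewrite ltnn.
by move=> /negP; rewrite -ltNge; lra.
Qed.

Lemma trivIset_annulus : trivIset setT annulus.
Proof.
have key n m r : annulus n r -> annulus m r -> ~ (n < m)%N.
  move=> /annulusP/andP[a b] /annulusP/andP[c d] nm.
  have : 2 ^- m <= 2 ^- n.+1 :> R.
    by rewrite lef_pV2 ?posrE ?exprn_gt0// ler_eXn2l ?ltr1n.
  lra.
apply/trivIsetP => n m _ _ nm; apply/seteqP; split=> // r [an am].
have [lt_nm|lt_mn|e] := ltngtP n m.
- exact: key an am lt_nm.
- exact: key am an lt_mn.
- by rewrite e eqxx in nm.
Qed.

Variable q : R.
Hypothesis q1 : 1 < q.
Hypothesis alpha_l2 : in_l2 alpha.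

Lemma alpha_bounded : exists B, forall n, normc (alpha n) <= B.
Proof.
have /in_l2P[S HS] := alpha_l2; exists (1 + S) => n.
have : normc (alpha n) ^+ 2 <= S.
  by apply: le_trans (HS n.+1); rewrite big_ord_recr /= lerDr sumr_ge0// => i _; rewrite sqr_ge0.
have := sqr_ge0 (normc (alpha n) - 1); rewrite sqrrB1; have := normc_ge0 (alpha n); lra.
Qed.

Definition besov_integrand (r : R) : \bar R :=
  (((1 - r) `^ (q / 2 - 1))%:E * poweR (circle_int (falpha alpha) r) (q / 2) * r%:E)%E.

Lemma dmass_ge0 r k : 0 <= r -> 0 <= dmass alpha r k.
Proof.
by move=> r0; rewrite /dmass !mulr_ge0 ?exprn_ge0 ?normc_ge0.
Qed.

Lemma pi_dmass_ge0 r k : 0 < r -> 0 <= 2 * pi * dmass alpha r k.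
Proof.
move=> r0; apply: mulr_ge0; first by rewrite mulr_ge0 ?pi_ge0.
by apply: dmass_ge0; exact: ltW.
Qed.

Lemma besov_integrand_ge0 r : 0 < r < 1 -> (0 <= besov_integrand r)%E.
Proof.
move=> /andP[r0 r1]; rewrite /besov_integrand !mule_ge0 ?lee_fin ?powR_ge0 ?poweR_ge0//.
exact: ltW.
Qed.

Lemma circle_intE r : 0 < r < 1 ->
  circle_int (falpha alpha) r = (\sum_(0 <= n <oo) (2 * pi * dmass alpha r n)%:E)%E.
Proof. by have [B HB] := alpha_bounded; exact: circle_int_falpha HB _. Qed.

(** Measurability in [r] of the circle integral comes from Parseval, which makes it a pointwise
    limit of polynomials in [r]. *)
Lemma measurable_besov_integrand : measurable_fun (`]0%R, 1%R[%classic : set R) besov_integrand.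
Proof.
rewrite /besov_integrand; apply: emeasurable_funM; last first.
  by apply/measurable_EFinP; exact: measurable_id.
apply: emeasurable_funM.
  apply/measurable_EFinP.
  apply: (@measurableT_comp _ _ _ _ _ _ (fun x => x `^ (q / 2 - 1))) => //.
  by apply: measurable_funB; [exact: measurable_cst|exact: measurable_id].
apply: (@measurableT_comp _ _ _ _ _ _ (fun x => poweR x (q / 2))).
  exact: measurable_poweR.
apply: (@emeasurable_fun_cvg _ _ _ _
  (fun N r => (\sum_(0 <= n < N) (2 * pi * dmass alpha r n)%:E)%E)).
  move=> N; apply: emeasurable_sum => n; apply/measurable_EFinP.
  rewrite /dmass; apply: measurable_funM => //; apply: measurable_funM => //.
move=> r; rewrite /= in_itv => r01; rewrite circle_intE//.
apply: is_cvg_nneseries => n _ _; rewrite lee_fin; apply: pi_dmass_ge0.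
by case/andP: r01.
Qed.

Lemma besov_integralE :
  (\int[lebesgue_measure]_(r in `]0%R, 1%R[%classic) besov_integrand r =
   \sum_(0 <= n <oo) \int[lebesgue_measure]_(r in annulus n) besov_integrand r)%E.
Proof.
rewrite -bigcup_annulus ge0_integral_bigcup//.
- exact: measurable_annulus.
- by rewrite bigcup_annulus; exact: measurable_besov_integrand.
- by move=> r [n _ /annulus_sub]; exact: besov_integrand_ge0.
- exact: trivIset_annulus.
Qed.

Lemma measurable_besov_annulus n : measurable_fun (annulus n) besov_integrand.
Proof.
apply: measurable_funS measurable_besov_integrand; first exact: measurable_itv.
by move=> r /annulus_sub; rewrite /= in_itv.
Qed.

Lemma annulus_integral_le n (V : R) : 0 <= V ->
  (forall r, annulus n r -> (besov_integrand r <= V%:E)%E) ->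
  (\int[lebesgue_measure]_(r in annulus n) besov_integrand r <= (V / 2 ^+ n.+1)%:E)%E.
Proof.
move=> V0 H.
have -> : (V / 2 ^+ n.+1)%:E = (\int[lebesgue_measure]_(r in annulus n) (cst V%:E) r)%E.
  rewrite integral_cst; last exact: measurable_annulus.
  by rewrite [X in _ = (_ * X)%E](annulus_measure n).
apply: ge0_le_integral => //; first exact: measurable_annulus.
- by move=> r /annulus_sub; exact: besov_integrand_ge0.
- exact: measurable_besov_annulus.
Qed.

Lemma annulus_integral_ge n (V : R) : 0 <= V ->
  (forall r, annulus n r -> (V%:E <= besov_integrand r)%E) ->
  ((V / 2 ^+ n.+1)%:E <= \int[lebesgue_measure]_(r in annulus n) besov_integrand r)%E.
Proof.
move=> V0 H.
have -> : (V / 2 ^+ n.+1)%:E = (\int[lebesgue_measure]_(r in annulus n) (cst V%:E) r)%E.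
  rewrite integral_cst; last exact: measurable_annulus.
  by rewrite [X in _ = (_ * X)%E](annulus_measure n).
apply: ge0_le_integral => //; first exact: measurable_annulus.
exact: measurable_besov_annulus.
Qed.

(** The exponent q/2 - 1 is negative for q < 2, so the two monotone factors (1 - r)^(q/2) and 1 / (1
    - r) are bounded separately. *)
Lemma weight_bounds (r : R) n : annulus n r ->
  (2 ^- n.+1) `^ (q / 2) * 2 ^+ n <= (1 - r) `^ (q / 2 - 1) <= (2 ^- n) `^ (q / 2) * 2 ^+ n.+1.
Proof.
move=> an; have /annulusP/andP[a b] := an; have /andP[r0 r1] := annulus_sub an.
have x0 : 0 < 1 - r by lra.
have [z0 _] := half_pow_bounds n.+1; have [y0 _] := half_pow_bounds n.
have p0 : 0 <= q / 2 by rewrite divr_ge0// ltW// (lt_trans ltr01).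
have -> : (1 - r) `^ (q / 2 - 1) = (1 - r) `^ (q / 2) * (1 - r)^-1.
  rewrite powRD; last by rewrite (gt_eqF x0) implybT.
  by rewrite powRN powRr1// ltW.
apply/andP; split.
- apply: ler_pM; rewrite ?powR_ge0 ?exprn_ge0//.
    by apply: le_powR2r; [exact: p0|exact: ltW|lra].
  by rewrite -[leLHS]invrK lef_pV2 ?posrE//; lra.
- apply: ler_pM; rewrite ?powR_ge0 ?invr_ge0 ?(ltW x0)//.
    by apply: le_powR2r; [exact: p0|exact: ltW|lra].
  by rewrite -[leRHS]invrK lef_pV2 ?posrE//; lra.
Qed.

Lemma dyadic_Besov : dyadic_cond q alpha -> in_Besov q (falpha alpha).
Proof.
move=> /dyadic_condP[S HS]; split.
  by have [B HB] := alpha_bounded; exact: falpha_holomorphic HB.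
have p0 : 0 < q / 2 by rewrite divr_gt0// (lt_trans ltr01).
have h01 : 0 <= (2^-1 : R) < 1 by rewrite invr_ge0 ler0n invf_lt1 ?ltr1n.
have [G G0 HG] := geometric_convolution_sup p0 h01.
have [|N|w [w0 wW wS]] := HG (fun k => beta alpha k ^+ 2) S.
- by move=> n; rewrite sqr_ge0.
- apply: le_trans (HS N); apply: ler_sum => k _.
  by rewrite beta_sqr beta_powR.
rewrite -/besov_integrand -[X in (X < _)%E]/(\int[lebesgue_measure]_(r in _) besov_integrand r)%E.
rewrite besov_integralE.
pose c : R := (32 * pi) `^ (q / 2).
have c0 : 0 <= c by exact: powR_ge0.
have pi0 := @pi_gt0 R.
have V n : (\int[lebesgue_measure]_(r in annulus n) besov_integrand r <= (c * w n `^ (q / 2))%:E)%E.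
  (* The powers of 2^n from the weight, the circle integral and the length of the annulus cancel; 32
     pi is 2 pi times the 16 of [sum_dmass_le]. *)
  pose V := (2 ^- n) `^ (q / 2) * 2 ^+ n.+1 * (32 * pi * 2 ^+ n * w n) `^ (q / 2).
  have V0 : 0 <= V by rewrite !mulr_ge0 ?powR_ge0 ?exprn_ge0.
  have -> : c * w n `^ (q / 2) = V / 2 ^+ n.+1.
    rewrite /V /c [RHS]mulrAC mulfK ?gt_eqF ?exprn_gt0//.
    rewrite -!powRM ?mulr_ge0 ?invr_ge0 ?exprn_ge0 ?(ltW pi0)//.
    by congr (_ `^ _); field; rewrite gt_eqF ?exprn_gt0.
  apply: annulus_integral_le => // r an.
  have /annulusP/andP[_ rn] := an; have r01 := annulus_sub an.
  have /andP[r0 r1] := r01.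
  rewrite /besov_integrand /V !EFinM.
  have /andP[_ wt] := weight_bounds an.
  have circ : (circle_int (falpha alpha) r <= (32 * pi * 2 ^+ n * w n)%:E)%E.
    rewrite circle_intE//; apply/nneseries_leP.
      by move=> k; exact: pi_dmass_ge0.
    move=> K; rewrite -mulr_sumr.
    have := sum_dmass_le K r0 rn; have := wW n K.+2 => h1 h2.
    have h3 : 16 * 2 ^+ n * \sum_(m < K.+2) 2^-1 ^+ (n - m + (m - n)) * beta alpha m ^+ 2 <= 16 * 2 ^+ n * w n.
      by rewrite ler_wpM2l// mulr_ge0// exprn_ge0.
    have := ler_wpM2l (ltW (mulr_gt0 (ltr0n R 2) pi0)) (le_trans h2 h3); lra.
  rewrite -[leRHS]mule1; apply: lee_pmul.
  - by rewrite mule_ge0 ?lee_fin ?powR_ge0 ?poweR_ge0.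
  - by rewrite lee_fin ltW.
  - apply: lee_pmul; rewrite ?lee_fin ?powR_ge0 ?poweR_ge0//.
    rewrite -poweR_EFin; apply: gt0_ler_poweR => //; rewrite ?in_itv/= ?leey ?andbT//.
      exact: ltW.
      by rewrite circle_intE//; apply: nneseries_ge0 => k _ _; rewrite lee_fin; exact: pi_dmass_ge0.
    by rewrite lee_fin !mulr_ge0 ?exprn_ge0 ?(ltW pi0).
  - by rewrite lee_fin ltW.
apply: (@le_lt_trans _ _ (\sum_(0 <= n <oo) (c * w n `^ (q / 2))%:E)%E).
  apply: lee_nneseries => n _ => //.
  by move=> _; apply: integral_ge0 => r /annulus_sub; exact: besov_integrand_ge0.
apply/nneseries_ltyP => [n|]; first by rewrite mulr_ge0 ?powR_ge0.
exists (c * (G * S)) => N; rewrite -mulr_sumr ler_wpM2l//.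
Qed.

(** Block [I_(n+1)] is read off on the annulus n + 1, where its powers of [r] are bounded below and
    the factor [r] is at least 1/2. *)
Lemma Besov_dyadic : in_Besov q (falpha alpha) -> dyadic_cond q alpha.
Proof.
move=> [_].
rewrite -[X in (X < _)%E]/(\int[lebesgue_measure]_(r in _) besov_integrand r)%E.
rewrite besov_integralE => fin.
have p0 : 0 < q / 2 by rewrite divr_gt0// (lt_trans ltr01).
(* The 4 collects r >= 1/2 and 2^(n+1) / 2^(n+2); the 32 is 2^(n+2) / 2^(n+1) times 16, and 16 comes
   from 2 pi / 64 >= 1/16. *)
pose c : R := 4^-1 * 32^-1 `^ (q / 2).
have c0 : 0 < c by rewrite mulr_gt0 ?powR_gt0 ?invr_gt0.
have pi2 : 2 <= pi :> R by exact: pi_ge2.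
have V n : ((c * beta alpha n.+1 `^ q)%:E <=
    \int[lebesgue_measure]_(r in annulus n.+1) besov_integrand r)%E.
  pose X := 2 ^+ n.+1 * beta alpha n.+1 ^+ 2 / 16.
  have X0 : 0 <= X.
    apply: mulr_ge0; last by rewrite invr_ge0.
    by apply: mulr_ge0; [exact: exprn_ge0|exact: sqr_ge0].
  pose V := (2 ^- n.+2) `^ (q / 2) * 2 ^+ n.+1 * X `^ (q / 2) * 2^-1.
  have V0 : 0 <= V by rewrite !mulr_ge0 ?powR_ge0 ?exprn_ge0 ?invr_ge0.
  have -> : c * beta alpha n.+1 `^ q = V / 2 ^+ n.+2.
    have -> : V = (2 ^- n.+2 * X) `^ (q / 2) * 2 ^+ n.+1 * 2^-1.
      by rewrite powRM// ?invr_ge0 ?exprn_ge0// /V; ring.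
    rewrite beta_powR -beta_sqr /c -[4^-1 * _ * _]mulrA -powRM ?invr_ge0 ?sqr_ge0//.
    have -> : 32^-1 * beta alpha n.+1 ^+ 2 = 2 ^- n.+2 * X.
      by rewrite /X [2 ^+ n.+2]exprS; field; rewrite gt_eqF ?exprn_gt0.
    by rewrite [2 ^+ n.+2 in RHS]exprS; field; rewrite gt_eqF ?exprn_gt0.
  apply: annulus_integral_ge => // r an.
  have /annulusP/andP[rn _] := an; have r01 := annulus_sub an.
  have /andP[r0 r1] := r01.
  rewrite /besov_integrand /V !EFinM.
  have /andP[wt _] := weight_bounds an.
  have circ : (X%:E <= circle_int (falpha alpha) r)%E.
    rewrite circle_intE//.
    apply: (@le_trans _ _ (\sum_(0 <= k < 2 ^ n.+1) (2 * pi * dmass alpha r k)%:E)%E); last first.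
      by apply: nneseries_lim_ge => k _ _; rewrite lee_fin; exact: pi_dmass_ge0.
    rewrite sumEFin lee_fin big_mkord -mulr_sumr.
    have h := sum_dmass_ge r01 rn.
    set Y := \sum_(k < _) _ in h *.
    apply: (@le_trans _ _ (4 * Y)); first by rewrite /X; lra.
    rewrite ler_wpM2r ?sumr_ge0//; [|lra].
    by move=> k _; rewrite dmass_ge0 ?(ltW r0).
  apply: lee_pmul.
  - by rewrite -!EFinM lee_fin !mulr_ge0 ?powR_ge0 ?exprn_ge0.
  - by rewrite lee_fin invr_ge0.
  - apply: lee_pmul; rewrite -?EFinM ?lee_fin ?mulr_ge0 ?powR_ge0 ?exprn_ge0//.
    rewrite -poweR_EFin; apply: gt0_ler_poweR => //; rewrite ?in_itv/= ?leey ?andbT//.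
      exact: ltW.
    by rewrite (le_trans _ circ)// lee_fin.
  - rewrite lee_fin; have [_ y1] := half_pow_bounds n.
    have : 2 ^- n.+1 = 2 ^- n / 2 :> R by rewrite exprS invfM mulrC.
    by move: rn; lra.
have : (\sum_(0 <= n <oo) ((if n is m.+1 then c * beta alpha m.+1 `^ q else 0))%:E < +oo)%E.
  apply: le_lt_trans fin; apply: lee_nneseries => [[|n] _ _|[|n] _].
  - exact: lexx.
  - by rewrite lee_fin mulr_ge0 ?powR_ge0// ltW.
  - by apply: integral_ge0 => r /annulus_sub; exact: besov_integrand_ge0.
  - exact: V.
move=> /nneseries_ltyP[[|n]//|S HS]; first by rewrite mulr_ge0 ?powR_ge0// ltW.
apply/dyadic_condP; exists (beta alpha 0 `^ q + S / c) => -[|N].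
  rewrite big_ord0 addr_ge0 ?powR_ge0// divr_ge0 ?(ltW c0)//.
  by have := HS 0%N; rewrite big_ord0.
rewrite big_ord_recl lerD2l ler_pdivlMr// mulr_suml.
apply: le_trans (HS N.+1); rewrite [leRHS]big_ord_recl /= add0r.
by apply: ler_sum => n _; rewrite mulrC.
Qed.

End Besov.

Theorem theorem1p3 (R : realType) (q : R) (alpha : seqC R) :
  1 < q -> in_l2 alpha ->
  [/\ (in_Schatten q (rhaly alpha) <-> in_Besov q (falpha alpha)),
      (in_Besov q (falpha alpha) <-> dyadic_cond q alpha) &
      (dyadic_cond q alpha <-> in_Schatten q (rhaly alpha))].
Proof.
move=> q1 al2.
have SD := @Schatten_dyadic R q alpha q1; have DS := dyadic_Schatten q1 al2.
have BD := Besov_dyadic q1 al2; have DB := dyadic_Besov q1 al2.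
by split; split => //; [move=> /SD | move=> /BD].
Qed.
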